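(* Let $v_1,\dots,v_n\in\mathbb{Z}^d$ span $\mathbb{R}^d$, ordered by $v_1<\cdots<v_n$ (identified with $1<\cdots<n$), let $Z=\{\sum_{i=1}^n\lambda_iv_i:0\le\lambda_i\le1\}$ be the $d$-dimensional lattice zonotope they generate, and let $\varphi$ be a $\mathbb{Z}^d$-valuation. Then \[h^{\varphi}(Z)(t)=\sum_{I\in\mathcal{I}}b_\varphi(I)\sum_{B\in\mathcal{B},\ B\supseteq I}A_{|I\cup\operatorname{IP}(B)|+1}(d+1,t).\]
   Context: A $\mathbb{Z}^d$-valuation is a map $\varphi$ from lattice polytopes in $\mathbb{R}^d$ (including $\emptyset$) to an abelian group with $\varphi(\emptyset)=0$, $\varphi(P\cup Q)=\varphi(P)+\varphi(Q)-\varphi(P\cap Q)$ whenever $P,Q,P\cup Q,P\cap Q$ are lattice polytopes, and $\varphi(P+x)=\varphi(P)$ for $x\in\mathbb{Z}^d$. For a $d$-dimensional lattice polytope $P$, $h^\varphi(P)(t)$ is the polynomial with $\sum_{n\ge0}\varphi(nP)t^n=h^\varphi(P)(t)/(1-t)^{d+1}$. $\varphi$ is extended to relative interiors by $\varphi(\operatorname{relint}P)=\sum_F(-1)^{\dim P-\dim F}\varphi(F)$, sum over nonempty faces $F$ of $P$. $\mathcal{I}$ is the set of linearly independent subsets $I\subseteq[n]$ (i.e. $\{v_i\}_{i\in I}$ independent), $\mathcal{B}$ the set of bases (maximal independent subsets). For $I\in\mathcal{I}$, $b_\varphi(I)=\varphi(\operatorname{relint}\{\sum_{i\in I}\lambda_iv_i:0\le\lambda_i\le1\})$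 (with $b_\varphi(\emptyset)=\varphi(\{0\})$). An element $i$ of a basis $B$ is internally passive if there is $j<i$, $j\notin B$, such that $(B\setminus\{i\})\cup\{j\}\in\mathcal{B}$; $\operatorname{IP}(B)$ is the set of internally passive elements of $B$. For $\sigma\in S_m$, $\operatorname{des}(\sigma)=|\{i\in[m-1]:\sigma_i>\sigma_{i+1}\}|$, and $A_j(m,t)=\sum_{\sigma\in S_m,\ \sigma_m=m+1-j}t^{\operatorname{des}(\sigma)}$ for $1\le j\le m$. *)

(* Defs.v *)
From HB Require Import structures.
From mathcomp Require Import all_boot all_order all_algebra all_fingroup.
From mathcomp Require Import all_classical reals.

Set Implicit Arguments.
Unset Strict Implicit.
Unset Printing Implicit Defensive.

Import Order.TTheory GRing.Theory Num.Theory.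
Local Open Scope ring_scope.

Section LatticePolytopes.
Variables (R : realType) (d : nat).
Implicit Types (P Q F S : set 'rV[R]_d).

Definition lat (x : 'rV[int]_d) : 'rV[R]_d := map_mx intr x.

Definition conv_hull (k : nat) (p : 'I_k -> 'rV[R]_d) : set 'rV[R]_d :=
  [set x | exists l : 'I_k -> R,
    [/\ forall i, 0 <= l i, \sum_i l i = 1 & x = \sum_i l i *: p i]]%classic.

(* The case k = 0 gives the empty polytope. *)
Definition lattice_polytope P : Prop :=
  exists (k : nat) (p : 'I_k -> 'rV[int]_d), P = conv_hull (fun i => lat (p i)).

Definition translate P (x : 'rV[int]_d) : set 'rV[R]_d :=
  [set y + lat x | y in P]%classic.

Definition dilate (m : nat) P : set 'rV[R]_d := [set m%:R *: y | y in P]%classic.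

Definition aff_indep (k : nat) (p : 'I_k.+1 -> 'rV[R]_d) : bool :=
  free [seq p (lift ord0 i) - p ord0 | i : 'I_k].

(* The dimension of the affine hull: the largest k such that S contains k + 1
   affinely independent points (0 for the empty set, which is never used). *)
Definition aff_dim S : nat :=
  \max_(k < d.+1 |
    `[< exists p : 'I_k.+1 -> 'rV[R]_d, (forall i, S (p i)) /\ aff_indep p >]) k.

(* The choice u = 0, c = 0 makes P a face of itself. *)
Definition face P F : Prop :=
  exists (u : 'cV[R]_d) (c : R),
    (forall x, P x -> (x *m u) 0 0 <= c) /\
    F = [set x | P x /\ (x *m u) 0 0 = c]%classic.

Definition nonempty_faces P : set (set 'rV[R]_d) :=
  [set F | face P F /\ F !=set0]%classic.

Variable G : zmodType.
Implicit Types phi : set 'rV[R]_d -> G.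

(* phi is a total function on subsets of R^d, but it is constrained, and below
   evaluated, only on lattice polytopes. *)
Definition Zd_valuation phi : Prop :=
  [/\ phi set0 = 0,
      forall P Q, lattice_polytope P -> lattice_polytope Q ->
        lattice_polytope (P `|` Q)%classic ->
        lattice_polytope (P `&` Q)%classic ->
        phi (P `|` Q)%classic = phi P + phi Q - phi (P `&` Q)%classic
    & forall P (x : 'rV[int]_d), lattice_polytope P ->
        phi (translate P x) = phi P].

(* The value phi(relint P) of the extension of phi to relative interiors. The
   sum is a finitely supported sum over a set; a polytope has finitely many
   faces. *)
Definition val_relint phi P : G :=
  \sum_(F \in nonempty_faces P) (phi F *~ (-1) ^+ (aff_dim P - aff_dim F)).

(* A power series with coefficients in the abelian group G is encoded by its
   coefficient sequence nat -> G; {poly int} acts on these by the Cauchy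
   product. *)
Definition poly_act (p : {poly int}) (f : nat -> G) : nat -> G :=
  fun k => \sum_(i < k.+1) f (k - i)%N *~ p`_i.

(* h is the (unique) polynomial over G such that
     sum_(m >= 0) phi(mP) t^m = h(t) / (1 - t)^(d + 1),
   for P of full dimension d. *)
Definition is_hpoly phi P (h : nat -> G) : Prop :=
  (exists N : nat, forall k, (N <= k)%N -> h k = 0) /\
  poly_act ((1 - 'X) ^+ d.+1) (fun m => phi (dilate m P)) = h.

End LatticePolytopes.

Section Zonotopes.
Variables (R : realType) (d n : nat) (v : 'I_n -> 'rV[int]_d).
Implicit Types (I B : {set 'I_n}).

Definition zonotope : set 'rV[R]_d :=
  [set x | exists l : 'I_n -> R,
    (forall i, 0 <= l i <= 1) /\ x = \sum_i l i *: lat R (v i)]%classic.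

Definition parallelepiped I : set 'rV[R]_d :=
  [set x | exists l : 'I_n -> R,
    (forall i, 0 <= l i <= 1) /\ x = \sum_(i in I) l i *: lat R (v i)]%classic.

Definition spanning : Prop := (<<[seq lat R (v i) | i : 'I_n]>> = fullv)%VS.

Definition indep I : bool := free [seq lat R (v i) | i in I].

Definition basis B : bool := maxset indep B.

Definition IP B : {set 'I_n} :=
  [set i in B | [exists j : 'I_n,
    [&& (j < i)%N, j \notin B & basis (j |: (B :\ i))]]]%SET.

Definition b_val (G : zmodType) (phi : set 'rV[R]_d -> G) I : G :=
  val_relint phi (parallelepiped I).

End Zonotopes.

Definition des (m : nat) (s : 'S_m) : nat :=
  #|[set i : 'I_m | [exists j : 'I_m, (j == i.+1 :> nat) && (s j < s i)%N]]%SET|.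

(* A_j(m, t). 'S_m permutes {0, ..., m - 1}, so the condition sigma_m = m + 1 - j
   bears on the index i with i + 1 = m and on the value (s i) + 1. *)
Definition A_poly (j m : nat) : {poly int} :=
  \sum_(s : 'S_m | [forall i : 'I_m, (i.+1 == m) ==> ((s i).+1 == m.+1 - j)%N])
    'X^(des s).

(* Main.v *)
Require Import Defs.
From HB Require Import structures.
From mathcomp Require Import all_boot all_order all_algebra all_fingroup.
From mathcomp Require Import all_classical reals.
From mathcomp Require Import zify ring lra.

Set Implicit Arguments.
Unset Strict Implicit.
Unset Printing Implicit Defensive.

Import Order.TTheory GRing.Theory Num.Theory.
Local Open Scope ring_scope.

(** For J a subset of [n] let Z_J be the zonotope generated by the v_i, i in J, and
    let c(I) be the alternating sum of phi(Z_J) over J in I.  Cutting a segment at a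
    lattice point shows that c(I) is homogeneous of degree 1 in every v_i, i in I, so
    phi(kZ) is the sum of k^|I| c(I) over all I.  Cutting the
    parallelograms on v_i, v_j and on v_i, v_i + v_j into the same two triangles, up to
    translation, shows that c(I) does not change when v_j is replaced by v_j + v_i; the
    Euclidean algorithm applied to an integer relation then turns some v_i into 0,
    hence c(I) = 0 for dependent I.  For independent I the faces of Z_I are translates
    of the Z_K, 2^|I - K| of each, so that b_phi(I) is the sum of (-2)^|I - K| phi(Z_K)
    and c(I) is the sum of b_phi(J) over J in I.  Every independent I lies in exactly
    one of the intervals [IP(B), B], which turns the sum of k^|I| over the independent
    I containing J into the sum of k^|J u IP(B)| (k+1)^(d - |J u IP(B)|) over the bases
    B containing J.  And A_{j+1}(d+1, t) is the numerator of the generating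
    function of k^j (k+1)^(d-j): both satisfy the recursion obtained by deleting the
    last entry of a permutation. *)

(** * Descents and the generating function of half-open cubes *)

(** This is A_{m+1-l}(m+1, t), indexed by the last value counted from 0, the form in which deleting
    the last entry gives a recursion in [m]. *)
Definition last_poly (m l : nat) : {poly int} :=
  \sum_(s : 'S_m.+1 | s ord_max == l :> nat) 'X^(des s).

Lemma A_poly_last (m j : nat) : (j <= m)%N ->
  A_poly j.+1 m.+1 = last_poly m (m - j).
Proof.
move=> jm; apply: eq_bigl => s; apply/forallP/eqP => [/(_ ord_max)|e i].
  by rewrite eqxx /= => /eqP; lia.
by apply/implyP => /eqP[im]; have -> : i = ord_max; [exact: val_inj|apply/eqP; lia].
Qed.

(** [lift_perm ord_max l s] appends the last value [l] to [s] and raises the values of [s] that are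
    at least [l]. This keeps the relative order inside [s], so only the join can contribute a new
    descent. *)
Lemma des_lift_perm (m : nat) (l : 'I_m.+2) (s : 'S_m.+1) :
  des (lift_perm ord_max l s) = (des s + (l <= s ord_max))%N.
Proof.
rewrite /des.
set D := [set i : 'I_m.+1 | _]%SET.
set D' := [set i : 'I_m.+2 | _]%SET.
have lm (i : 'I_m.+1) : lift ord_max i = i :> nat by rewrite lift_max.
have D'l (i : 'I_m.+1) : i \in D -> lift ord_max i \in D'.
  rewrite !inE => /existsP[j /andP[/eqP ji sji]]; apply/existsP.
  exists (lift ord_max j); rewrite !lm ji eqxx /= !lift_perm_lift /= /bump; lia.
(* [lift ord_max ord_max] is the penultimate position; its value is raised past [l] exactly when it
   was at least [l]. *)
have D'm : (lift ord_max ord_max \in D') = (l <= s ord_max)%N.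
  rewrite inE; apply/existsP/idP => [[j]|ls]; last first.
    exists ord_max; rewrite lm eqxx /= lift_perm_lift lift_perm_id /= /bump.
    move: ls; case: leqP => //; lia.
  case: (unliftP ord_max j) => [j'|] ->.
    rewrite !lm => /andP[/eqP /= e _]; have := ltn_ord j'. by rewrite e ltnn.
  by case/andP=> _; rewrite lift_perm_lift lift_perm_id /= /bump; lia.
have -> : D' = ((lift ord_max @: D) :|:
    (if (l <= s ord_max)%N then [set lift ord_max ord_max] else finset.set0))%SET.
  apply/setP => i; rewrite finset.in_setU; case: (unliftP ord_max i) => [i'|] ->; last first.
    rewrite !inE; apply/idP/orP => [/existsP[j /andP[/eqP]]|].
      by have := ltn_ord j => /=; lia.
    case=> [/imsetP[x _ /eqP]|]; first by rewrite (negbTE (neq_lift _ _)).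
    case: ifP => _; rewrite !inE // => /eqP/eqP.
    by rewrite (negbTE (neq_lift _ _)).
  rewrite mem_imset; last exact: lift_inj.
  have [->|im] := eqVneq i' ord_max.
    rewrite D'm; case: ifP => ls; rewrite !inE ?eqxx ?orbT // orbF.
    apply/esym/negbTE/existsP => -[j /andP[/eqP]]; have := ltn_ord j => /=; lia.
  have -> : (lift ord_max i' \in if (l <= s ord_max)%N
      then [set lift ord_max ord_max]%SET else finset.set0) = false.
    by case: ifP => _; rewrite inE // (inj_eq lift_inj) (negbTE im).
  rewrite orbF; apply/idP/idP; last exact: D'l.
  rewrite !inE => /existsP[j /andP[/eqP ji sji]]; apply/existsP.
  move: ji sji; rewrite lm; case: (unliftP ord_max j) => [j'|] -> => ji sji.
    exists j'; move: ji sji; rewrite lm => ->.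
    by rewrite eqxx /= !lift_perm_lift /= /bump; lia.
  by move: im; rewrite -val_eqE /=; move: ji => /=; lia.
rewrite cardsU disjoint_setI0 ?cards0 ?subn0.
  by rewrite card_imset; [case: ifP; rewrite ?cards1 ?cards0|exact: lift_inj].
rewrite disjoint_sym finset.disjoints_subset; apply/fintype.subsetP => x.
case: ifP; rewrite ?inE // => _ /eqP ->.
rewrite mem_imset; last exact: lift_inj.
rewrite inE; apply/existsP => -[j /andP[/eqP]]; have := ltn_ord j => /=; lia.
Qed.

Lemma lift_perm_imset (m : nat) (l : 'I_m.+2) :
  [set s : 'S_m.+2 | s ord_max == l]%SET = [set lift_perm ord_max l t | t in 'S_m.+1]%SET.
Proof.
apply/setP => s; rewrite inE; apply/eqP/imsetP => [sl|[t _ ->]]; last exact: lift_perm_id.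
(* By injectivity only the last position takes the value [l], so every other value lies in the range
   of [lift l]; the preimages [k'] form the permutation left after deleting the last entry. *)
have f k : {k' | s (lift ord_max k) = lift l k'}.
  case: (unliftP l (s (lift ord_max k))) => [k'|] e; first by exists k'.
  by move: e; rewrite -sl => /perm_inj/eqP; rewrite eq_sym (negbTE (neq_lift _ _)).
have f_inj : injective (fun k => sval (f k)).
  move=> x y /(congr1 (lift l)); rewrite -!(svalP (f _)).
  by move=> /perm_inj/lift_inj.
exists (perm f_inj) => //; apply/permP => k.
case: (unliftP ord_max k) => [k'|] ->; last by rewrite lift_perm_id.
by rewrite lift_perm_lift permE -(svalP (f k')).
Qed.

Lemma last_poly_rec (m l : nat) : (l <= m.+1)%N ->
  last_poly m.+1 l =
  \sum_(s : 'S_m.+1) 'X^(des s) * 'X^(l <= s ord_max)%N.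
Proof.
move=> lm; pose l' : 'I_m.+2 := inord l.
have l'E : l' = l :> nat by rewrite inordK.
transitivity (\sum_(s in [set s : 'S_m.+2 | s ord_max == l']%SET) 'X^(des s) : {poly int}).
  by apply: eq_bigl => s; rewrite inE -val_eqE /= l'E.
rewrite lift_perm_imset big_imset /= => [|s t _ _ /permP st]; last first.
  by apply/permP => k; have := st (lift ord_max k); rewrite !lift_perm_lift => /lift_inj.
by apply: eq_bigr => s _; rewrite des_lift_perm l'E exprD.
Qed.

(** In [last_poly_rec] the summands for [l] and [l.+1] differ only at permutations ending in [l],
    where the last factors are ['X] and 1. *)
Lemma last_poly_diff (m l : nat) : (l <= m)%N ->
  last_poly m.+1 l - last_poly m.+1 l.+1 = ('X - 1) * last_poly m l.
Proof.
move=> lm; rewrite !last_poly_rec; [|lia..].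
rewrite -sumrB mulr_sumr [RHS]big_mkcond /=; apply: eq_bigr => s _.
have [h|h|h] := ltngtP l (s ord_max); rewrite ?subrr ?mulr1 ?expr1 //.
by rewrite mulrBl mul1r mulrC.
Qed.

(** Appending the smallest value always creates a descent, appending the largest never does. *)
Lemma last_poly_wrap (m : nat) : last_poly m.+1 0 = 'X * last_poly m.+1 m.+1.
Proof.
rewrite !last_poly_rec // mulr_sumr; apply: eq_bigr => s _.
by rewrite leq0n leqNgt ltn_ord mulr1 mulrC.
Qed.

Lemma last_poly00 : last_poly 0 0 = 1.
Proof.
rewrite /last_poly (big_pred1 (1%g : 'S_1)) => [|s].
  rewrite /des cardsE eq_card0 ?expr0 // => i; rewrite inE.
  by apply/negbTE/existsP => -[j]; rewrite !ord1.
have -> : s = 1%g by apply/permP => i; rewrite !ord1.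
by rewrite /= perm1 eqxx.
Qed.

(** Congruence modulo ['X^N], which lets truncated polynomials stand for power series. *)
Definition eq_upto (N : nat) (p q : {poly int}) := forall k, (k < N)%N -> p`_k = q`_k.

Lemma eq_upto_mull N r p q : eq_upto N p q -> eq_upto N (r * p) (r * q).
Proof.
move=> h k kN; rewrite !coefM; apply: eq_bigr => i _; rewrite h //; lia.
Qed.

(* k^(m - l) (k + 1)^l counts the lattice points of the k-th dilate of a unit
   m-cube with m - l pairwise non-parallel facets removed. *)
Definition cube_gf (N m l : nat) : {poly int} :=
  \poly_(k < N) ((k ^ (m - l) * k.+1 ^ l)%N%:Z).

Lemma cube_gf_diff N m l : (l <= m)%N ->
  cube_gf N m.+1 l - cube_gf N m.+1 l.+1 = - cube_gf N m l.
Proof.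
move=> lm; apply/polyP => k; rewrite !coefE; case: ifP => _; last by rewrite subrr oppr0.
rewrite subSS (subSn lm) !expnS; nia.
Qed.

(** Shifting k by one turns (k+1)^(m+1) into k^(m+1), and the constant term is 0^(m+1) = 0. The
    truncation spoils equality at degree [N]. *)
Lemma cube_gf_wrap N m : eq_upto N (cube_gf N m.+1 0) ('X * cube_gf N m.+1 m.+1).
Proof.
move=> k kN; rewrite coefXM !coef_poly kN; case: k kN => [|k] kN /=.
  by rewrite subn0 exp0n.
by rewrite ltnW // subn0 subnn expn0 mul1n muln1.
Qed.

Lemma eq_upto_X N p : eq_upto N p ('X * p) -> eq_upto N p 0.
Proof.
move=> h; elim=> [|k IH] kN; rewrite h // coefXM /= ?coef0 //.
by rewrite IH ?coef0 // ltnW.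
Qed.

(** Both sides obey the same difference relation in [l] and the same wrap relation. By induction on
    [m] their difference [D l] is independent of [l] modulo ['X^N]; wrapping then gives D = X D,
    which forces D to vanish. *)
Lemma cube_gfE N m l : (l <= m)%N ->
  eq_upto N ((1 - 'X) ^+ m.+1 * cube_gf N m l) (last_poly m l).
Proof.
elim: m l => [|m IH] l lm.
  move: lm; rewrite leqn0 => /eqP -> k kN; rewrite last_poly00 expr1 mulrBl mul1r.
  rewrite coefB coefXM !coef_poly kN coef1 /=.
  case: k kN => [|k] kN /=; first by rewrite subr0.
  by rewrite ltnW //  subrr.
pose D l := (1 - 'X) ^+ m.+2 * cube_gf N m.+1 l - last_poly m.+1 l.
have Dstep i : (i <= m)%N -> eq_upto N (D i) (D i.+1).
  move=> im k kN; apply/eqP; rewrite -subr_eq0 -coefB.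
  have -> : D i - D i.+1 = (1 - 'X) * (last_poly m i - (1 - 'X) ^+ m.+1 * cube_gf N m i).
    transitivity ((1 - 'X) ^+ m.+2 * (cube_gf N m.+1 i - cube_gf N m.+1 i.+1)
        - (last_poly m.+1 i - last_poly m.+1 i.+1)); first by rewrite /D; ring.
    by rewrite cube_gf_diff // last_poly_diff // exprS; ring.
  have h : eq_upto N (last_poly m i - (1 - 'X) ^+ m.+1 * cube_gf N m i) 0.
    by move=> j jN; rewrite coefB IH // subrr coef0.
  by rewrite (eq_upto_mull _ h) // mulr0 coef0.
have Dall i : (i <= m.+1)%N -> eq_upto N (D 0) (D i).
  elim: i => [//|i IHi] im k kN; by rewrite (IHi (ltnW im)) // Dstep.
have Dw : eq_upto N (D 0) ('X * D m.+1).
  move=> k kN; rewrite /D mulrBr -last_poly_wrap !coefB; congr (_ - _).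
  rewrite mulrCA; apply: (eq_upto_mull _ (@cube_gf_wrap N m)) => //.
have D0 : eq_upto N (D m.+1) 0.
  by apply: eq_upto_X => k kN; rewrite -Dw // (Dall m.+1).
move=> k kN; apply/eqP; rewrite -subr_eq0 -coefB -/(D l) -(Dall l) // (Dall m.+1) //.
by rewrite D0 // coef0.
Qed.

Lemma A_poly_coef (d j k : nat) : (j <= d)%N ->
  (A_poly j.+1 d.+1)`_k =
  \sum_(i < k.+1) ((1 - 'X) ^+ d.+1)`_i * ((k - i) ^ j * (k - i).+1 ^ (d - j))%N%:Z.
Proof.
move=> jd; rewrite A_poly_last // -(@cube_gfE k.+1) ?leq_subr // coefM.
apply: eq_bigr => i _; rewrite coef_poly subKn //.
by rewrite ltnS leq_subr.
Qed.

(** * Sums over subsets *)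

Section SubsetSums.
Variables (T : finType) (G : zmodType).
Implicit Types (f g : {set T} -> G) (I J : {set T}) (c : int).

(** For c = 1 this is the zeta transform of the Boolean lattice, for c = -1 its Möbius inverse; c =
    -2 describes [b_val]. *)
Definition subset_sum c f I : G :=
  \sum_(J : {set T} | J \subset I) f J *~ c ^+ #|I :\: J|%SET.

Lemma eq_subset_sum c f g I : (forall J, J \subset I -> f J = g J) ->
  subset_sum c f I = subset_sum c g I.
Proof. by move=> e; apply: eq_bigr => J JI; rewrite e. Qed.

Lemma subset_sumD c f g a I :
  subset_sum c (fun J => f J + g J *~ a) I = subset_sum c f I + subset_sum c g I *~ a.
Proof.
rewrite /subset_sum mulrz_suml -big_split /=; apply: eq_bigr => J _.
by rewrite mulrzDl mulrzAC.
Qed.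

Lemma subset_sum0 c f : subset_sum c f finset.set0 = f finset.set0.
Proof.
rewrite /subset_sum (big_pred1 finset.set0) => [|J]; last by rewrite finset.subset0.
by rewrite finset.setDv cards0 expr0.
Qed.

(** Subsets of [I] pair up as J and [i |: J] with J avoiding [i]; the one without [i] misses one
    more element, hence the factor [c]. *)
Lemma subset_sum_split c f I i : i \in I ->
  subset_sum c f I = subset_sum c (fun J => f (i |: J)%SET + f J *~ c) (I :\ i)%SET.
Proof.
move=> iI; rewrite subset_sumD {1}/subset_sum (bigID (fun J => i \in J)) /=.
congr (_ + _).
  rewrite (reindex_onto (fun J => i |: J)%SET (fun J => J :\ i)%SET) /=; last first.
    by move=> J /andP[_ iJ]; rewrite finset.setD1K.
  apply: eq_big => [J|J _].
    rewrite finset.subUset finset.sub1set iI /= subsetD1 setU11 andbT.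
    have [iJ|iJ] := boolP (i \in J); last by rewrite finset.setU1K // eqxx andbT.
    rewrite [in RHS]andbF; apply/negbTE/negP => /andP[_ /eqP e].
    by move: iJ; rewrite -e !inE eqxx.
  by congr (_ *~ _ ^+ #|pred_of_set _|); rewrite finset.setDDl.
rewrite /subset_sum mulrz_suml; apply: eq_big => [J|J /andP[JI iJ]].
  by rewrite subsetD1.
rewrite -mulrzA -exprSr; congr (_ *~ _ ^+ _).
rewrite (cardsD1 i (I :\: J)) !inE iJ iI add1n; congr _.+1.
by rewrite !finset.setDDl finset.setUC.
Qed.

(** The transforms form a one-parameter group. Splitting off [i] reduces both sides to the function
    f(J + i) + (a + b) f(J) on subsets of I - i. *)
Lemma subset_sum_comp a b f I :
  subset_sum a (subset_sum b f) I = subset_sum (a + b) f I.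
Proof.
move: {2}#|I| (leqnn #|I|) => N; elim: N I f => [|N IH] I f.
  by rewrite leqn0 cards_eq0 => /eqP ->; rewrite !subset_sum0.
have [->|[i iI]] := set_0Vmem I; first by rewrite !subset_sum0.
rewrite (cardsD1 i) iI ltnS => IN.
rewrite !(subset_sum_split _ _ iI) -IH //; apply: eq_subset_sum => J.
rewrite subsetD1 => /andP[JI iJ].
rewrite (subset_sum_split _ _ (setU11 i J)) finset.setU1K // -subset_sumD.
by apply: eq_subset_sum => K _; rewrite -addrA -mulrzDr [b + a]addrC.
Qed.

Lemma subset_sum_inv f I : subset_sum 1 (subset_sum (-1) f) I = f I.
Proof.
rewrite subset_sum_comp subrr /subset_sum (bigD1 I) //= finset.setDv cards0 expr0 mulr1z.
rewrite big1 ?addr0 // => J /andP[JI JnI]; rewrite expr0n cards_eq0.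
case: eqP => [/eqP|_]; last by rewrite mulr0z.
by rewrite finset.setD_eq0 => IJ; rewrite finset.eqEsubset JI IJ in JnI.
Qed.

End SubsetSums.

Lemma subset_sum_const (T : finType) (c : int) (A : {set T}) :
  \sum_(J : {set T} | J \subset A) c ^+ #|A :\: J|%SET = (1 + c) ^+ #|A|.
Proof.
have -> : \sum_(J : {set T} | J \subset A) c ^+ #|A :\: J|%SET =
    subset_sum c (fun=> 1) A.
  by apply: eq_bigr => J _; rewrite -mulrzr mul1r intz.
move: {2}#|A| (leqnn #|A|) => N; elim: N A => [|N IH] A.
  by rewrite leqn0 cards_eq0 => /eqP ->; rewrite subset_sum0 cards0 expr0.
have [->|[i iA]] := set_0Vmem A; first by rewrite subset_sum0 cards0 expr0.
rewrite (cardsD1 i A) iA ltnS => AN; rewrite (subset_sum_split _ _ iA) exprD expr1.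
by rewrite subset_sumD IH // -mulrzr intz; ring.
Qed.

Lemma sum_subsets (T : finType) (c : int) (A : {set T}) :
  \sum_(J : {set T} | J \subset A) c ^+ #|J| = (1 + c) ^+ #|A|.
Proof.
have DD (J : {set T}) : J \subset A -> (A :\: (A :\: J))%SET = J.
  by move=> JA; rewrite finset.setDDr finset.setDv finset.set0U; apply/finset.setIidPr.
rewrite -subset_sum_const.
rewrite (reindex_onto (fun J => A :\: J)%SET (fun J => A :\: J)%SET) //=.
apply: eq_bigl => J; rewrite finset.subsetDl /=; apply/eqP/idP => [<-|/DD //].
exact: finset.subsetDl.
Qed.

Lemma sum_interval (T : finType) (c : int) (K B : {set T}) : K \subset B ->
  \sum_(I : {set T} | (K \subset I) && (I \subset B)) c ^+ #|I| =
  c ^+ #|K| * (1 + c) ^+ (#|B| - #|K|).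
Proof.
move=> KB; have -> : (#|B| - #|K| = #|B :\: K|%SET)%N.
  by rewrite cardsD (finset.setIidPr KB).
rewrite -sum_subsets mulr_sumr.
rewrite (reindex_onto (fun J => K :|: J)%SET (fun J => J :\: K)%SET) /=; last first.
  move=> J /andP[KJ _]; apply/setP => i; rewrite !inE.
  by case: (boolP (i \in K)) => [/(fintype.subsetP KJ) ->|].
have UD (J : {set T}) : ((K :|: J) :\: K == J)%SET = [disjoint J & K].
  by rewrite finset.setDUl finset.setDv finset.set0U; apply/eqP/finset.setDidPl.
apply: eq_big => [J|J].
  by rewrite UD finset.subsetUl finset.subUset KB /= finset.subsetD.
rewrite UD => /andP[_ JK]; rewrite -exprD; congr (_ ^+ _).
by rewrite cardsU disjoint_setI0 ?cards0 ?subn0 // disjoint_sym.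
Qed.

(** * Linear independence over the lattice *)

Section Independence.
Variables (R : realType) (d n : nat) (v : 'I_n -> 'rV[int]_d).
Implicit Types (I J B : {set 'I_n}).
Local Notation V i := (lat R (v i)).

(** Kept over the integers, so that its ranks over the rationals and over [R] can be compared. *)
Definition gen_mx I : 'M[int]_(#|I|, d) := \matrix_k v (enum_val k).

Lemma sum_gen_mx I (l : 'I_n -> R) :
  (\row_k l (enum_val k)) *m map_mx intr (gen_mx I) = \sum_(i in I) l i *: V i.
Proof.
rewrite mulmx_sum_row [RHS]big_enum_val /=; apply: eq_bigr => k _; rewrite mxE.
by congr (_ *: _); apply/rowP => j; rewrite !mxE.
Qed.

Lemma indep_row_free I : indep R v I = row_free (map_mx (intr : int -> R) (gen_mx I)).
Proof.
have sz : size [seq V i | i in I] = #|I| by rewrite size_map -cardE.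
have nthV (k : 'I_#|I|) : [seq V i | i in I]`_k = V (enum_val k).
  rewrite (nth_map (enum_val k)) -?cardE //; congr (V _).
  by rewrite /enum_val; apply: set_nth_default; rewrite -cardE.
rewrite /indep; apply/idP/idP => [fr|rf].
  apply: inj_row_free => c /eqP c0; apply/rowP => k; rewrite !mxE.
  have := @freeP _ _ _ (tcast sz (in_tuple [seq V i | i in I])).
  rewrite val_tcast => h; move/h: fr => /(_ (fun k => c 0 k)); apply.
  rewrite -[RHS](eqP c0) mulmx_sum_row; apply: eq_bigr => j _.
  by rewrite nthV; congr (_ *: _); apply/rowP => x; rewrite !mxE.
have := @freeP _ _ _ (tcast sz (in_tuple [seq V i | i in I])).
rewrite val_tcast => h; apply/h => c c0 k.
have : (\row_k c k) *m map_mx intr (gen_mx I) = 0.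
  rewrite -[RHS]c0 mulmx_sum_row; apply: eq_bigr => j _.
  by rewrite nthV mxE; congr (_ *: _); apply/rowP => x; rewrite !mxE.
by move/eqP; rewrite mulmx_free_eq0 // => /eqP/rowP/(_ k); rewrite !mxE.
Qed.

Lemma indepP I :
  reflect (forall l : 'I_n -> R, \sum_(i in I) l i *: V i = 0 -> {in I, forall i, l i = 0})
          (indep R v I).
Proof.
rewrite indep_row_free; apply: (iffP idP) => [rf l l0 i iI|h].
  move/eqP: l0; rewrite -sum_gen_mx mulmx_free_eq0 // => /eqP/rowP/(_ (enum_rank_in iI i)).
  by rewrite !mxE enum_rankK_in.
apply: inj_row_free => c c0; apply/rowP => k; rewrite mxE.
pose l i := if i \in I =P true is ReflectT iI then c 0 (enum_rank_in iI i) else 0.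
have lE k' : l (enum_val k') = c 0 k'.
  rewrite /l; case: eqP => [iI|]; first by rewrite enum_valK_in.
  by rewrite enum_valP.
rewrite -lE; apply: h (enum_valP k); rewrite -sum_gen_mx -[RHS]c0; congr (_ *m _).
by apply/rowP => k'; rewrite mxE.
Qed.

Lemma indep_sub I J : J \subset I -> indep R v I -> indep R v J.
Proof.
move=> JI /indepP h; apply/indepP => l l0 i iJ.
have := h (fun i => if i \in J then l i else 0).
move=> /(_ _ i (fintype.subsetP JI i iJ)); rewrite iJ; apply.
rewrite -[RHS]l0 [RHS]big_mkcond [LHS]big_mkcond /=; apply: eq_bigr => j _.
case: ifP => jI; case: ifP => jJ //; first by rewrite scale0r.
by rewrite (fintype.subsetP JI j jJ) in jI.
Qed.

(** A right inverse of the row-free generator matrix yields a functional with prescribed values; it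
    serves to exhibit faces and to read off coefficients. *)
Lemma indep_dual I (t : 'I_n -> R) : indep R v I ->
  exists u : 'cV[R]_d, {in I, forall i, (V i *m u) 0 0 = t i}.
Proof.
rewrite indep_row_free => rf; pose M := map_mx (intr : int -> R) (gen_mx I).
exists (pinvmx M *m \col_k t (enum_val k)) => i iI.
have e : row (enum_rank_in iI i) M = V i.
  by apply/rowP => j; rewrite !mxE enum_rankK_in.
by rewrite -e -row_mul mulmxA mulmxVp // mul1mx !mxE enum_rankK_in.
Qed.

Lemma indep_card I : indep R v I -> (#|I| <= d)%N.
Proof. by rewrite indep_row_free => /eqP <-; exact: rank_leq_col. Qed.

(** Rank does not change under field extension, so a real dependence gives a rational one; clearing
    denominators makes it integral. *)
Lemma dep_int_relation I : ~~ indep R v I ->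
  exists2 a : 'I_n -> int, \sum_(i in I) a i *: v i = 0 & exists2 i, i \in I & a i != 0.
Proof.
rewrite indep_row_free.
have -> : map_mx (intr : int -> R) (gen_mx I) =
    map_mx (ratr : rat -> R) (map_mx intr (gen_mx I)).
  by rewrite -map_mx_comp; apply: eq_map_mx => z /=; rewrite ratr_int.
rewrite /row_free mxrank_map -/(row_free _) -kermx_eq0.
move=> /rowV0Pn[c /sub_kermxP c0 /rV0Pn[k ck]].
pose D := \prod_j denq (c 0 j).
have D0 : D != 0 by apply/prodf_neq0 => j _; rewrite denq_neq0.
(* This is the integer D c_j, written without division. *)
pose b j := numq (c 0 j) * \prod_(j' | j' != j) denq (c 0 j').
have bE j : (b j)%:~R = D%:~R * c 0 j :> rat.
  rewrite /b /D [in RHS](bigD1 j) //= 2!rmorphM /= numqE; ring.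
pose a i := if i \in I =P true is ReflectT iI then b (enum_rank_in iI i) else 0.
have aE k' : a (enum_val k') = b k'.
  rewrite /a; case: eqP => [iI|]; first by rewrite enum_valK_in.
  by rewrite enum_valP.
exists a; last first.
  exists (enum_val k); rewrite ?enum_valP // aE -(intr_eq0 rat) bE mulf_neq0 //.
  by rewrite intr_eq0.
rewrite big_enum_val /=; apply/rowP => j; rewrite summxE mxE; apply/eqP.
rewrite -(intr_eq0 rat) rmorph_sum /=; apply/eqP.
move/rowP: c0 => /(_ j); rewrite !mxE => /(congr1 (fun x => D%:~R * x)).
rewrite mulr0 mulr_sumr => c0; rewrite -[RHS]c0; apply: eq_bigr => k' _.
by rewrite !mxE aE intrM bE mulrA.
Qed.

End Independence.

(** * Bases and internal passivity *)

Section Bases.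
Variables (R : realType) (d n : nat) (v : 'I_n -> 'rV[int]_d).
Implicit Types (I J B : {set 'I_n}).
Local Notation V i := (lat R (v i)).
Local Notation indep := (indep R v).
Local Notation basis := (basis R v).
Local Notation IP := (IP R v).

Lemma basis_indep B : basis B -> indep B.
Proof. by case/maxsetP. Qed.

Lemma basis_repr B j : basis B -> exists l : 'I_n -> R, V j = \sum_(i in B) l i *: V i.
Proof.
case/maxsetP => iB mB; have [jB|jB] := boolP (j \in B).
  exists (fun i => (i == j)%:R); rewrite (bigD1 j) //= eqxx scale1r big1 ?addr0 //.
  by move=> i /andP[_ /negbTE ->]; rewrite scale0r.
apply: contrapT => nl; have : indep (j |: B)%SET.
  apply/indepP => l; rewrite big_setU1 //= => l0.
  have lj : l j = 0.
    apply/eqP/negPn/negP => lj; apply: nl; exists (fun i => - (l i / l j)).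
    have -> : V j = (l j)^-1 *: (l j *: V j) by rewrite scalerA mulVf // scale1r.
    rewrite (_ : l j *: V j = - \sum_(i in B) l i *: V i); last first.
      by apply/eqP; rewrite -addr_eq0 l0.
    rewrite scalerN scaler_sumr -sumrN; apply: eq_bigr => i _.
    by rewrite scalerA scaleNr mulrC.
  move: l0; rewrite lj scale0r add0r => l0 i; rewrite !inE => /predU1P[-> //|].
  by move/indepP: iB => /(_ l l0 i).
move=> h; have := mB _ h (finset.subsetUr _ _) => e.
by move: jB; rewrite -e setU11.
Qed.

Hypothesis spv : spanning R v.

Lemma basis_card B : basis B = indep B && (#|B| == d).
Proof.
apply/idP/andP => [bB|[iB /eqP cB]]; last first.
  apply/maxsetP; split=> // B' iB' BB'; apply/eqP; rewrite eq_sym eqEcard BB' cB.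
  exact: indep_card iB'.
split; first exact: basis_indep.
rewrite eqn_leq (indep_card (basis_indep bB)) /=.
have : (fullv <= <<[seq V i | i in B]>>)%VS.
  rewrite -spv; apply/span_subvP => x /mapP[j _ ->].
  have [l ->] := basis_repr j bB; apply: memv_suml => i iB; apply: memvZ.
  by apply/memv_span/map_f; rewrite mem_enum.
move/dimvS; rewrite dimvf /dim /= mul1n => h; apply: leq_trans h _.
by apply: leq_trans (dim_span _) _; rewrite size_map -cardE.
Qed.

Lemma basis_exchange B i j (l : 'I_n -> R) : basis B -> i \in B -> j \notin B ->
  V j = \sum_(k in B) l k *: V k -> l i != 0 -> basis (j |: (B :\ i))%SET.
Proof.
move=> bB iB jB Vj li; have jBi : j \notin (B :\ i)%SET by rewrite !inE (negbTE jB) andbF.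
move: (bB); rewrite !basis_card => /andP[fB /eqP cB].
apply/andP; split; last by rewrite cardsU1 jBi -cB (cardsD1 i B) iB.
apply/indepP => c; rewrite big_setU1 //= Vj scaler_sumr [in X in X + _](bigD1 i) //=.
have e : \sum_(k in (B :\ i)%SET) c k *: V k = \sum_(k in B | k != i) c k *: V k.
  by apply: eq_bigl => k; rewrite !inE andbC.
rewrite e -addrA -big_split /= => c0.
(* Coefficients after substituting the expansion of [V j]; since [i] was removed from [B], its
   coefficient is [c j * l i] alone, which forces [c j = 0]. *)
pose m k := if k == i then c j * l i else c j * l k + c k.
have m0 : \sum_(k in B) m k *: V k = 0.
  rewrite -[RHS]c0 (bigD1 i) //= /m eqxx scalerA; congr (_ + _).
  by apply: eq_bigr => k /andP[_ /negbTE ->]; rewrite scalerDl scalerA.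
move/indepP: fB => /(_ _ m0) mB.
have cj : c j = 0.
  by have := mB i iB; rewrite /m eqxx => /eqP; rewrite mulf_eq0 (negbTE li) orbF => /eqP.
move=> k; rewrite !inE => /predU1P[-> //|/andP[ki kB]].
by have := mB k kB; rewrite /m (negbTE ki) cj mul0r add0r.
Qed.

Lemma IP_sub B : IP B \subset B.
Proof. by apply/fintype.subsetP => i; rewrite inE => /andP[]. Qed.

(** Among the bases containing [I] take one with the least sum of indices: exchanging an internally
    passive element outside [I] for a smaller one would lower the sum. *)
Lemma IP_basis_exists I : indep I ->
  exists B, [/\ basis B, I \subset B & IP B \subset I].
Proof.
move=> iI; have [B0 bB0 IB0] := maxset_exists iI.
have P0 : basis B0 && (I \subset B0) by apply/andP.
case: (@arg_minnP _ B0 (fun B => basis B && (I \subset B))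
  (fun B : {set 'I_n} => \sum_(i in B) i)%N P0) => B /andP[bB IB] mB.
exists B; split=> //; apply/fintype.subsetP => i; rewrite inE => /andP[iB /existsP[j]].
move=> /and3P[ji jB bB']; apply/negPn/negP => iI'.
have := mB (j |: (B :\ i))%SET; rewrite bB' /=.
have -> : I \subset (j |: (B :\ i))%SET.
  apply/fintype.subsetP => k kI; rewrite !inE (fintype.subsetP IB k kI) andbT.
  by rewrite (_ : k != i) ?orbT //; apply: contraNneq iI' => <-.
move=> /(_ isT); rewrite big_setU1 /=; last by rewrite !inE (negbTE jB) andbF.
rewrite (big_setD1 i) //= leq_add2r; lia.
Qed.

(* The least element m of the symmetric difference, say m in B', is spanned by
   elements of B that lie in I or precede m; all of them belong to B'. *)
Lemma IP_basis_unique I B B' : basis B -> basis B' -> I \subset B -> I \subset B' ->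
  IP B \subset I -> IP B' \subset I -> B = B'.
Proof.
move=> bB bB' IB IB' PB PB'; apply/eqP/negPn/negP => BB'.
have [m0 Pm0] : exists m, (m \in B) != (m \in B').
  apply: contrapT => h; case/negP: BB'; apply/eqP/setP => m.
  by apply/eqP/negPn/negP => hm; apply: h; exists m.
case: (@arg_minnP _ m0 (fun m => (m \in B) != (m \in B'))
  (fun m : 'I_n => m : nat) Pm0) => m Pm mm {m0 Pm0}.
wlog mB : B B' bB bB' IB IB' PB PB' BB' Pm mm / m \notin B.
  move=> wl; have [mB|mB] := boolP (m \in B); last exact: (wl B B').
  apply: (wl B' B); rewrite 1?eq_sym //.
    by move=> k kB; apply: mm; rewrite eq_sym.
  by move: Pm; rewrite mB; case: (m \in B').
have mB' : m \in B' by move: Pm; rewrite (negbTE mB); case: (m \in B').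
have [l Vm] := basis_repr m bB.
have lB' k : k \in B -> l k != 0 -> k \in B'.
  move=> kB lk; have [kI|kI] := boolP (k \in I); first exact: (fintype.subsetP IB').
  have km : (k < m)%N.
    rewrite ltn_neqAle; apply/andP; split.
      by apply: contraNneq mB => e; rewrite (_ : m = k) //; exact/val_inj.
    rewrite leqNgt; apply/negP => mk; case/negP: kI; apply: (fintype.subsetP PB).
    rewrite inE kB; apply/existsP; exists m; rewrite mk mB /=.
    exact: (basis_exchange bB kB mB Vm lk).
  apply/negPn/negP => kB'; have := mm k; rewrite kB (negbTE kB') => /(_ isT).
  by rewrite leqNgt km.
pose c k := if k == m then -1 else if k \in B then l k else 0.
have c0 : \sum_(k in B') c k *: V k = 0.
  rewrite (bigD1 m) //= /c eqxx scaleN1r Vm addrC; apply/eqP; rewrite subr_eq0; apply/eqP.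
  rewrite big_mkcond [RHS]big_mkcond /=; apply: eq_bigr => k _.
  have [->|km] := eqVneq k m; first by rewrite andbF (negbTE mB).
  rewrite andbT; have [kB|kB] := boolP (k \in B); last by rewrite scale0r if_same.
  case: ifPn => // kB'; have [->|lk] := eqVneq (l k) 0; first by rewrite scale0r.
  by rewrite (lB' k kB lk) in kB'.
move/indepP: (basis_indep bB') => /(_ _ c0 m mB'); rewrite /c eqxx => /eqP.
by rewrite oppr_eq0 oner_eq0.
Qed.

(** The intervals [IP(B), B] partition the independent sets; the members of one that contain [J]
    form the interval from [J :|: IP B] to [B], nonempty only if [J] lies in [B]. *)
Lemma sum_indep_basis (c : int) J :
  \sum_(I : {set 'I_n} | indep I && (J \subset I)) c ^+ #|I| =
  \sum_(B : {set 'I_n} | basis B && (J \subset B))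
    c ^+ #|J :|: IP B|%SET * (1 + c) ^+ (d - #|J :|: IP B|%SET).
Proof.
have e B : basis B && (J \subset B) ->
    c ^+ #|J :|: IP B|%SET * (1 + c) ^+ (d - #|J :|: IP B|%SET) =
    \sum_(I : {set 'I_n} | ((J :|: IP B)%SET \subset I) && (I \subset B)) c ^+ #|I|.
  case/andP=> bB JB; rewrite sum_interval ?finset.subUset ?JB ?IP_sub //.
  by move: bB; rewrite basis_card => /andP[_ /eqP ->].
rewrite (eq_bigr _ e) (exchange_big_dep (fun I => indep I && (J \subset I))) /=; last first.
  move=> B I /andP[bB JB]; rewrite finset.subUset => /andP[/andP[JI _] IB].
  by rewrite JI andbT; apply: indep_sub IB (basis_indep bB).
apply: eq_bigr => I /andP[iI JI]; have [B [bB IB PB]] := IP_basis_exists iI.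
rewrite (big_pred1 B) // => B'; apply/idP/eqP => [|->].
  case/andP=> /andP[bB' JB']; rewrite finset.subUset => /andP[/andP[_ PB'] IB'].
  exact: (@IP_basis_unique I).
by rewrite bB finset.subUset JI PB IB (fintype.subset_trans JI IB).
Qed.

End Bases.

(** * Minkowski sums and elementary dissections *)

Section MinkowskiSums.
Variables (R : realType) (d : nat).
Implicit Types (P Q S : set 'rV[R]_d) (u w x : 'rV[int]_d).

Local Notation lat := (@lat R d).

Definition msum P Q : set 'rV[R]_d :=
  [set y | exists p q, [/\ P p, Q q & y = p + q]]%classic.

Definition segment u : set 'rV[R]_d :=
  [set y | exists a : R, 0 <= a <= 1 /\ y = a *: lat u]%classic.

(** The convex hull of 0, u and u + w, one half of the parallelogram on u and w. *)
Definition triangle u w : set 'rV[R]_d :=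
  [set y | exists a b : R, [/\ 0 <= b, b <= a, a <= 1 & y = a *: lat u + b *: lat w]]%classic.

Definition convex_set Q : Prop :=
  forall (x y : 'rV[R]_d) (s : R), Q x -> Q y -> 0 <= s <= 1 -> Q ((1 - s) *: x + s *: y).

Lemma latD u w : lat (u + w) = lat u + lat w.
Proof. exact: map_mxD. Qed.

Lemma lat0 : lat 0 = 0.
Proof. exact: map_mx0. Qed.

Lemma latMn u k : lat (u *+ k) = k%:R *: lat u.
Proof. by rewrite /lat raddfMn /= scaler_nat. Qed.

Lemma lattice_polytope_fin (T : finType) (p : T -> 'rV[int]_d) :
  lattice_polytope [set y | exists l : T -> R,
    [/\ forall i, 0 <= l i, \sum_i l i = 1 & y = \sum_i l i *: lat (p i)]]%classic.
Proof.
exists #|T|, (fun i => p (enum_val i)); apply/seteqP; split=> x [l [l0 l1 ->]].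
  exists (fun i => l (enum_val i)); split=> //.
    by rewrite -l1 (reindex _ (onW_bij _ (@enum_val_bij T))).
  by rewrite (reindex _ (onW_bij _ (@enum_val_bij T))).
exists (fun i => l (enum_rank i)); split=> //.
  by rewrite -l1 (reindex _ (onW_bij _ (@enum_rank_bij T))).
rewrite (reindex _ (onW_bij _ (@enum_rank_bij T))).
by apply: eq_bigr => i _; rewrite enum_rankK.
Qed.

(** Products of weights give weights on the pairwise sums of vertices; conversely, the two marginals
    of such weights recover a point of each summand. *)
Lemma lattice_polytope_msum P Q :
  lattice_polytope P -> lattice_polytope Q -> lattice_polytope (msum P Q).
Proof.
move=> [k [p ->]] [l [q ->]].
rewrite (_ : msum _ _ = [set y | exists c : 'I_k * 'I_l -> R,
    [/\ forall i, 0 <= c i, \sum_i c i = 1 &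
        y = \sum_i c i *: lat (p i.1 + q i.2)]]%classic).
  exact: lattice_polytope_fin.
apply/seteqP; split=> x.
  move=> [_ [_ [[a [a0 a1 ->]] [b [b0 b1 ->]] ->]]].
  exists (fun i => a i.1 * b i.2); split.
  - by move=> i; rewrite mulr_ge0.
  - rewrite -(pair_bigA _ (fun i j => a i * b j)) /= -a1.
    by apply: eq_bigr => i _; rewrite -mulr_sumr b1 mulr1.
  rewrite -(pair_bigA _ (fun i j => (a i * b j) *: lat (p i + q j))) /=.
  have e i : \sum_j (a i * b j) *: lat (p i + q j) =
      a i *: lat (p i) + \sum_j (a i * b j) *: lat (q j).
    under eq_bigr => j _ do rewrite latD scalerDr.
    by rewrite big_split /= -scaler_suml -mulr_sumr b1 mulr1.
  rewrite (eq_bigr _ (fun i _ => e i)).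
  rewrite big_split /=; congr (_ + _); rewrite exchange_big /=.
  by apply: eq_bigr => j _; rewrite -scaler_suml -mulr_suml a1 mul1r.
move=> [c [c0 c1 ->]].
exists (\sum_i (\sum_j c (i, j)) *: lat (p i)), (\sum_j (\sum_i c (i, j)) *: lat (q j)).
split.
- exists (fun i => \sum_j c (i, j)); split=> //.
    by move=> i; apply: sumr_ge0.
  by rewrite pair_bigA -c1; apply: eq_bigr => -[].
- exists (fun j => \sum_i c (i, j)); split=> //.
    by move=> i; apply: sumr_ge0.
  by rewrite exchange_big pair_bigA -c1; apply: eq_bigr => -[].
under [X in _ = X + _]eq_bigr do rewrite scaler_suml.
under [X in _ = _ + X]eq_bigr do rewrite scaler_suml.
rewrite [X in _ = _ + X]exchange_big !pair_bigA -big_split /=.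
by apply: eq_bigr => -[i j] _; rewrite latD scalerDr.
Qed.

Lemma lattice_polytope_point x : lattice_polytope [set lat x]%classic.
Proof.
rewrite (_ : [set lat x]%classic = [set y | exists l : unit -> R,
    [/\ forall i, 0 <= l i, \sum_i l i = 1 & y = \sum_i l i *: lat x]]%classic).
  exact: lattice_polytope_fin.
apply/seteqP; split=> y /=.
  move=> ->; exists (fun=> 1); split=> [_||]; rewrite ?ler01 //.
    by rewrite (big_pred1 tt) //; case.
  by rewrite (big_pred1 tt) ?scale1r //; case.
by move=> [l [_ l1 ->]]; rewrite -scaler_suml l1 scale1r.
Qed.

Lemma lattice_polytope_segment u : lattice_polytope (segment u).
Proof.
rewrite (_ : segment u = [set y | exists l : bool -> R,
    [/\ forall i, 0 <= l i, \sum_i l i = 1 &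
        y = \sum_i l i *: lat (if i then u else 0)]]%classic).
  exact: lattice_polytope_fin.
apply/seteqP; split=> y /=.
  move=> [a [/andP[a0 a1] ->]]; exists (fun b : bool => if b then a else 1 - a).
  split; first by case; rewrite ?subr_ge0.
    by rewrite big_bool /= addrCA subrr addr0.
  by rewrite big_bool /= lat0 scaler0 addr0.
move=> [l [l0 l1 ->]]; exists (l true); rewrite big_bool /= lat0 scaler0 addr0.
by split=> //; move: l1 (l0 true) (l0 false); rewrite big_bool /=; lra.
Qed.

Lemma lattice_polytope_triangle u w : lattice_polytope (triangle u w).
Proof.
pose p (i : 'I_3) := if i == 0 :> nat then 0 else if i == 1%N :> nat then u else u + w.
rewrite (_ : triangle u w = [set y | exists l : 'I_3 -> R,
    [/\ forall i, 0 <= l i, \sum_i l i = 1 & y = \sum_i l i *: lat (p i)]]%classic).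
  exact: lattice_polytope_fin.
apply/seteqP; split=> y /=.
  move=> [a [b [b0 ba a1 ->]]].
  (* Barycentric coordinates 1 - a, a - b, b with respect to 0, u, u + w. *)
  exists (fun i => if i == 0 :> nat then 1 - a else if i == 1%N :> nat then a - b else b).
  rewrite !big_ord_recl !big_ord0 /p /= lat0 latD scaler0 add0r !addr0; split.
  - by move=> i; case: ifP => _; [|case: ifP => _]; lra.
  - by lra.
  by rewrite scalerDr addrA -scalerDl subrK.
move=> [l [l0 l1 ->]].
move: l1 (l0 ord0) (l0 (lift ord0 ord0)) (l0 (lift ord0 (lift ord0 ord0))).
rewrite !big_ord_recl !big_ord0 /p /= lat0 latD !addr0.
set a0 := l _; set a1 := l _; set a2 := l _ => l1 l00 l01 l02.
exists (a1 + a2), a2; split; first exact: l02; first (by lra); first (by lra).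
by rewrite scaler0 add0r scalerDr addrA scalerDl.
Qed.

Lemma lattice_polytope_convex Q : lattice_polytope Q -> convex_set Q.
Proof.
move=> [k [q ->]] x y s [a [a0 a1 ->]] [b [b0 b1 ->]] /andP[s0 s1].
exists (fun i => (1 - s) * a i + s * b i); split.
- by move=> i; rewrite addr_ge0 // mulr_ge0 // subr_ge0.
- by rewrite big_split /= -!mulr_sumr a1 b1; lra.
rewrite !scaler_sumr -big_split /=; apply: eq_bigr => i _.
by rewrite [RHS]scalerDl !scalerA.
Qed.

Lemma msum_translate Q P x : msum Q (translate P x) = translate (msum Q P) x.
Proof.
apply/seteqP; split=> y /=.
  move=> [q [_ [Qq [p Pp <-] ->]]]; exists (q + p); last by rewrite addrA.
  by exists q, p.
move=> [_ [q [p [Qq Pp ->]]] <-]; exists q, (p + lat x); split=> //; last by rewrite addrA.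
by exists p.
Qed.

Lemma msum0 Q : msum Q [set 0]%classic = Q.
Proof.
apply/seteqP; split=> y /=; first by move=> [q [_ [Qq -> ->]]]; rewrite addr0.
by move=> Qy; exists y, 0; rewrite addr0.
Qed.

Lemma msumA P Q S : msum (msum P Q) S = msum P (msum Q S).
Proof.
apply/seteqP; split=> y /=.
  move=> [_ [s [[p [q [Pp Qq ->]]] Ss ->]]]; exists p, (q + s).
  by split; rewrite ?addrA //; exists q, s.
move=> [p [_ [Pp [q [s [Qq Ss ->]]] ->]]]; exists (p + q), s.
by split; rewrite ?addrA //; exists p, q.
Qed.

Lemma translate_point x : translate [set 0]%classic x = [set lat x]%classic.
Proof.
apply/seteqP; split=> y /=; first by move=> [_ -> <-]; rewrite add0r.
by move=> ->; exists 0; rewrite ?add0r.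
Qed.

Lemma lattice_polytope_translate P x :
  lattice_polytope P -> lattice_polytope (translate P x).
Proof.
move=> LP; rewrite -[P]msum0 -msum_translate translate_point.
by apply: lattice_polytope_msum => //; exact: lattice_polytope_point.
Qed.

(** Locates the crossing point between two pieces of a cut, given an affine parameter that is
    nonpositive on one and nonnegative on the other. *)
Lemma segment_crossing (a b : R) : a <= 0 <= b ->
  exists2 s, 0 <= s <= 1 & (1 - s) * a + s * b = 0.
Proof.
move=> /andP[a0 b0]; have [ab|ab] := eqVneq a b.
  by exists 0; rewrite ?lexx ?ler01 //; move: ab; lra.
have ab0 : 0 < b - a by rewrite subr_gt0 lt_neqAle ab; lra.
exists (- a / (b - a)).
  by rewrite ler_pdivrMr // ler_pdivlMr // mul0r mul1r; lra.
by field; rewrite gt_eqF.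
Qed.

Variables (G : zmodType) (phi : set 'rV[R]_d -> G).
Hypothesis phiV : Zd_valuation phi.

(* Convexity of Q moves the crossing point of P1 and P2 into Q + P0, so the two
   pieces Q + P1 and Q + P2 meet exactly in Q + P0. *)
Lemma valuation_cut Q P P1 P2 P0 :
  lattice_polytope Q -> lattice_polytope P -> lattice_polytope P1 ->
  lattice_polytope P2 -> lattice_polytope P0 ->
  (P = P1 `|` P2)%classic -> (P0 `<=` P1)%classic -> (P0 `<=` P2)%classic ->
  (forall x y : 'rV[R]_d, P1 x -> P2 y ->
     exists2 s : R, 0 <= s <= 1 & P0 ((1 - s) *: x + s *: y)) ->
  phi (msum Q P) = phi (msum Q P1) + phi (msum Q P2) - phi (msum Q P0).
Proof.
move=> LQ LP LP1 LP2 LP0 PE P01 P02 cr.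
have UE : msum Q P = (msum Q P1 `|` msum Q P2)%classic.
  rewrite PE; apply/seteqP; split=> x /=.
    move=> [q [p [Qq [Pp|Pp] ->]]]; [left|right]; by exists q, p.
  move=> [[q [p [Qq Pp ->]]]|[q [p [Qq Pp ->]]]]; exists q, p; split=> //.
    by left.
  by right.
have IE : msum Q P0 = (msum Q P1 `&` msum Q P2)%classic.
  apply/seteqP; split=> x /=.
    by move=> [q [p [Qq Pp ->]]]; split; exists q, p; split=> //; [exact: P01|exact: P02].
  move=> [[q [p [Qq Pp ->]]] [q' [p' [Qq' Pp' e]]]].
  have [s s01 P0s] := cr p p' Pp Pp'.
  exists ((1 - s) *: q + s *: q'), ((1 - s) *: p + s *: p'); split=> //.
    exact: lattice_polytope_convex.
  by rewrite addrACA -!scalerDr -e -scalerDl subrK scale1r.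
have [_ + _] := phiV; rewrite UE IE; apply; rewrite -?UE -?IE;
  exact: lattice_polytope_msum.
Qed.

Lemma val_translate Q P x : lattice_polytope Q -> lattice_polytope P ->
  phi (msum Q (translate P x)) = phi (msum Q P).
Proof.
move=> LQ LP; have [_ _ tr] := phiV; rewrite msum_translate tr //.
exact: lattice_polytope_msum.
Qed.

Lemma val_point Q x : lattice_polytope Q -> phi (msum Q [set lat x]%classic) = phi Q.
Proof.
move=> LQ; rewrite -translate_point val_translate ?msum0 //.
by rewrite -lat0; exact: lattice_polytope_point.
Qed.

(** Cut the segment from 0 to (k+1)u at the lattice point ku; the far piece is a translate of the
    segment of u. *)
Lemma val_segmentS Q u k : lattice_polytope Q ->
  phi (msum Q (segment (u *+ k.+1))) =
  phi (msum Q (segment (u *+ k))) + phi (msum Q (segment u)) - phi Q.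
Proof.
move=> LQ; rewrite -(val_translate (u *+ k) LQ (lattice_polytope_segment u)).
rewrite -[in RHS](val_point (u *+ k) LQ).
have Ls := lattice_polytope_segment.
have k0 : 0 <= k%:R :> R by rewrite ler0n.
apply: valuation_cut => //.
- exact: lattice_polytope_translate.
- exact: lattice_polytope_point.
- apply/seteqP; split=> x /=.
    move=> [a [/andP[a0 a1] ->]]; have [h|h] := leP (a * k.+1%:R) k%:R.
      (* The witness below divides by [k], so the degenerate segment is separate. *)
      left; have [k00|k00] := posnP k.
        exists 0; rewrite lexx ler01 scale0r; split=> //.
        move: h; rewrite k00 mulr1 => h; have -> : a = 0 by lra.
        by rewrite scale0r.
      have kp : 0 < k%:R :> R by rewrite ltr0n.
      exists (a * k.+1%:R / k%:R); split.
        rewrite ler_pdivrMr // ler_pdivlMr // mul0r mul1r h mulr_ge0 //.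
      by rewrite !latMn !scalerA; congr (_ *: _); field; rewrite gt_eqF.
    right; exists ((a * k.+1%:R - k%:R) *: lat u).
      exists (a * k.+1%:R - k%:R); split=> //; move: h; rewrite -natr1; nra.
    by rewrite !latMn scalerA -scalerDl subrK.
  move=> [[a [/andP[a0 a1] ->]]|[_ [a [/andP[a0 a1] ->]] <-]].
    have kS : 0 < k.+1%:R :> R by rewrite ltr0n.
    exists (a * k%:R / k.+1%:R); split.
      rewrite ler_pdivrMr // ler_pdivlMr // mul0r mul1r mulr_ge0 //= -natr1; nra.
    by rewrite !latMn !scalerA divfK ?gt_eqF.
  have kS : 0 < k.+1%:R :> R by rewrite ltr0n.
  exists ((a + k%:R) / k.+1%:R); split.
    rewrite ler_pdivrMr // ler_pdivlMr // mul0r mul1r addr_ge0 //= -natr1; nra.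
  rewrite !latMn !scalerA -scalerDl; by rewrite divfK ?gt_eqF.
- by move=> x /= ->; exists 1; rewrite ler01 lexx scale1r.
- move=> x /= ->; exists 0; last by rewrite add0r.
  by exists 0; rewrite ler01 lexx scale0r.
move=> x y /= [a [/andP[a0 a1] ->]] [_ [b [/andP[b0 b1] ->]] <-].
have [|s s01 se] := @segment_crossing (a * k%:R - k%:R) b; first by nra.
exists s => //; rewrite !latMn !scalerA -scalerDl scalerA -scalerDl.
by congr (_ *: _); move: se; lra.
Qed.

Lemma val_segmentMn Q u k : lattice_polytope Q ->
  phi (msum Q (segment (u *+ k))) - phi Q =
  (phi (msum Q (segment u)) - phi Q) *+ k.
Proof.
move=> LQ; elim: k => [|k IH].
  rewrite mulr0n (_ : segment 0 = [set lat 0]%classic) ?val_point ?subrr //.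
  apply/seteqP; split=> x /=; first by move=> [a [_ ->]]; rewrite lat0 scaler0.
  by move=> ->; exists 0; rewrite lexx ler01 lat0 scaler0.
by rewrite val_segmentS // mulrSr -IH addrACA !addrA.
Qed.

Lemma val_parallelogram Q u w : lattice_polytope Q ->
  phi (msum Q (msum (segment u) (segment w))) =
  phi (msum Q (triangle u w)) + phi (msum Q (triangle w u)) -
  phi (msum Q (segment (u + w))).
Proof.
move=> LQ; have Ls := lattice_polytope_segment; have Lt := lattice_polytope_triangle.
apply: valuation_cut => //.
- exact: lattice_polytope_msum.
- apply/seteqP; split=> x /=.
    move=> [_ [_ [[a [/andP[a0 a1] ->]] [b [/andP[b0 b1] ->]] ->]]].
    have [ba|ab] := leP b a; [left|right]; first by exists a, b.
    by exists b, a; split; rewrite ?(ltW ab) // addrC.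
  move=> [[a [b [b0 ba a1 ->]]]|[b [a [a0 ab b1 ->]]]].
    exists (a *: lat u), (b *: lat w); split=> //.
      by exists a; split=> //; lra.
    by exists b; split=> //; lra.
  exists (a *: lat u), (b *: lat w); split; rewrite 1?addrC //.
    by exists a; split=> //; lra.
  by exists b; split=> //; lra.
- move=> x [a [/andP[a0 a1] ->]]; exists a, a; split=> //.
  by rewrite latD scalerDr.
- move=> x [a [/andP[a0 a1] ->]]; exists a, a; split=> //.
  by rewrite addrC latD scalerDr.
move=> x y [a [b [b0 ba a1 ->]]] [b' [a' [a'0 ab' b'1 ->]]].
have [|s s01 se] := @segment_crossing (b - a) (b' - a'); first by lra.
exists s => //; exists ((1 - s) * a + s * a'); split; first by move/andP: s01 => [? ?]; nra.
have e : (1 - s) * a + s * a' = (1 - s) * b + s * b' by move: se; lra.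
by rewrite latD [RHS]scalerDr {2}e; apply/rowP => i; rewrite !mxE; ring.
Qed.

(** Cut along the diagonal from u to u + w, a translate of the segment of w. The pieces are the
    triangle 0, u, u + w and the translate by u of the triangle 0, w, u + w: the same two as for the
    parallelogram on u and w. *)
Lemma val_sheared_parallelogram Q u w : lattice_polytope Q ->
  phi (msum Q (msum (segment u) (segment (w + u)))) =
  phi (msum Q (triangle u w)) + phi (msum Q (triangle w u)) -
  phi (msum Q (segment w)).
Proof.
move=> LQ; have Ls := lattice_polytope_segment; have Lt := lattice_polytope_triangle.
rewrite -(val_translate u LQ (Lt w u)) -(val_translate u LQ (Ls w)).
apply: valuation_cut => //.
- exact: lattice_polytope_msum.
- exact: lattice_polytope_translate.
- exact: lattice_polytope_translate.
- apply/seteqP; split=> x /=.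
    move=> [_ [_ [[a [/andP[a0 a1] ->]] [b [/andP[b0 b1] ->]] ->]]].
    have [h|h] := leP (a + b) 1; [left|right].
      exists (a + b), b; split=> //; first by lra.
      by rewrite latD scalerDr scalerDl [b *: _ + _]addrC addrA.
    exists (b *: lat w + (a + b - 1) *: lat u); first by exists b, (a + b - 1); split=> //; lra.
    by rewrite latD scalerDr scalerBl scale1r !scalerDl addrA subrK addrCA.
  move=> [[a [b [b0 ba a1 ->]]]|[_ [b [a [a0 ab b1 ->]] <-]]].
    exists ((a - b) *: lat u), (b *: lat (w + u)); split=> //.
    - by exists (a - b); split=> //; lra.
    - by exists b; split=> //; lra.
    by rewrite latD scalerDr scalerBl [b *: _ + _]addrC addrA subrK.
  exists ((1 + a - b) *: lat u), (b *: lat (w + u)); split=> //.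
  - by exists (1 + a - b); split=> //; lra.
  - by exists b; split=> //; lra.
  by rewrite latD; apply/rowP => i; rewrite !mxE; ring.
- move=> _ [_ [a [/andP[a0 a1] ->]] <-]; exists 1, a; split=> //.
  by rewrite scale1r addrC.
- move=> _ [_ [a [/andP[a0 a1] ->]] <-]; exists (a *: lat w) => //.
  by exists a, 0; split=> //; rewrite scale0r addr0.
move=> x y [a [b [b0 ba a1 ->]]] [_ [b' [a' [a'0 ab' b'1 ->]] <-]].
(* The cut is where the coefficient of u equals 1; these are the excesses over 1 on the two
   pieces. *)
have [|s s01 se] := @segment_crossing (a - 1) a'; first by lra.
exists s => //; exists (((1 - s) * b + s * b') *: lat w).
  by exists ((1 - s) * b + s * b'); split=> //; move/andP: s01 => [? ?]; nra.
have e : (1 - s) * a + s * (a' + 1) = 1 by move: se; lra.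
transitivity (((1 - s) * b + s * b') *: lat w + ((1 - s) * a + s * (a' + 1)) *: lat u).
  by rewrite e scale1r.
by apply/rowP => i; rewrite !mxE; ring.
Qed.

Lemma val_transvection Q u w : lattice_polytope Q ->
  phi (msum Q (msum (segment u) (segment (w + u)))) - phi (msum Q (segment (w + u))) =
  phi (msum Q (msum (segment u) (segment w))) - phi (msum Q (segment w)).
Proof.
move=> LQ; rewrite val_sheared_parallelogram // val_parallelogram // [u + w]addrC.
by rewrite addrAC.
Qed.

End MinkowskiSums.

(** * Alternating sums over zonotopes *)

Lemma finset_ind (T : finType) (P : {set T} -> Prop) :
  P finset.set0 -> (forall i (J : {set T}), i \notin J -> P J -> P (i |: J)%SET) -> forall J, P J.
Proof.
move=> P0 PU J; move: {2}#|J| (leqnn #|J|) => N; elim: N J => [|N IH] J.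
  by rewrite leqn0 cards_eq0 => /eqP ->.
have [->|[i iJ]] := set_0Vmem J; first by [].
rewrite (cardsD1 i) iJ ltnS -(finset.setD1K iJ) => JN.
by apply: PU; rewrite ?setD11 //; apply: IH; rewrite finset.setU1K ?setD11 in JN.
Qed.

Section Parallelepipeds.
Variables (R : realType) (d n : nat).
Implicit Types (v w : 'I_n -> 'rV[int]_d) (I J : {set 'I_n}).

Lemma parallelepiped0 v : parallelepiped v finset.set0 = [set 0 : 'rV[R]_d]%classic.
Proof.
apply/seteqP; split=> x /=; first by move=> [l [_ ->]]; rewrite big_set0.
by move=> ->; exists (fun=> 0); split=> [i|]; rewrite ?lexx ?ler01 ?big_set0.
Qed.

Lemma parallelepipedU1 v i J : i \notin J ->
  parallelepiped (R := R) v (i |: J)%SET = msum (parallelepiped v J) (segment (v i)).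
Proof.
move=> iJ; apply/seteqP; split=> x /=.
  move=> [l [l01 ->]]; rewrite big_setU1 //=.
  exists (\sum_(j in J) l j *: lat R (v j)), (l i *: lat R (v i)).
  by split; rewrite 1?addrC //; [exists l|exists (l i)].
move=> [_ [_ [[l [l01 ->]] [a [a01 ->]] ->]]].
exists (fun j => if j == i then a else l j); split; first by move=> j; case: ifP.
rewrite big_setU1 //= eqxx addrC; congr (_ + _); apply: eq_bigr => j jJ.
by case: eqP => // ji; rewrite -ji jJ in iJ.
Qed.

Lemma lattice_parallelepiped v J : lattice_polytope (parallelepiped (R := R) v J).
Proof.
elim/finset_ind: J => [|i J iJ LJ].
  by rewrite parallelepiped0 -(lat0 R d); exact: lattice_polytope_point.
rewrite parallelepipedU1 //; apply: lattice_polytope_msum => //.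
exact: lattice_polytope_segment.
Qed.

Lemma eq_parallelepiped v w J : {in J, v =1 w} ->
  parallelepiped (R := R) v J = parallelepiped w J.
Proof.
move=> e; apply/seteqP; split=> x [l [l01 ->]]; exists l; split=> //;
  by apply: eq_bigr => i iJ; rewrite e.
Qed.

Lemma zonotopeE v : zonotope (R := R) v = parallelepiped v [set: 'I_n]%SET.
Proof.
by apply/seteqP; split=> x [l [l01 ->]]; exists l; split=> //; apply: eq_bigl => i;
  rewrite inE.
Qed.

Lemma dilate_zonotope v k :
  dilate k (zonotope (R := R) v) = zonotope (fun i => v i *+ k).
Proof.
apply/seteqP; split=> x /=.
  move=> [_ [l [l01 ->]] <-]; exists l; split=> //.
  by rewrite scaler_sumr; apply: eq_bigr => i _; rewrite latMn !scalerA mulrC.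
move=> [l [l01 ->]]; exists (\sum_i l i *: lat R (v i)); first by exists l.
by rewrite scaler_sumr; apply: eq_bigr => i _; rewrite latMn !scalerA mulrC.
Qed.

Variables (G : zmodType) (phi : set 'rV[R]_d -> G).
Hypothesis phiV : Zd_valuation phi.

(* In the polytope algebra this is the value of phi at the product over I of the
   half-open segments [S_i] - [0]. *)
Definition alt_val v I : G := subset_sum (-1) (fun J => phi (parallelepiped v J)) I.

Lemma eq_alt_val v w I : {in I, v =1 w} -> alt_val v I = alt_val w I.
Proof.
move=> e; apply: eq_subset_sum => J JI; congr phi; apply: eq_parallelepiped => i iJ.
by apply: e; apply: (fintype.subsetP JI).
Qed.

(** Splitting off [i] leaves differences phi(P + S_i) - phi(P), each of which is multiplied by k
    when v_i is. *)
Lemma alt_val_scale1 v w I i k : i \in I -> w i = v i *+ k ->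
  (forall j, j != i -> w j = v j) -> alt_val w I = alt_val v I *+ k.
Proof.
move=> iI wi wj; rewrite /alt_val !(subset_sum_split _ _ iI) /subset_sum -sumrMnl.
apply: eq_bigr => J; rewrite subsetD1 => /andP[_ iJ].
have e : parallelepiped (R := R) w J = parallelepiped v J.
  apply: eq_parallelepiped => j jJ; apply: wj.
  by apply: contraNneq iJ => <-.
rewrite !parallelepipedU1 // e wi !mulrN1z val_segmentMn //; last exact: lattice_parallelepiped.
by rewrite !pmulrn mulrzAC.
Qed.

Lemma alt_val_scale v I k :
  alt_val (fun i => v i *+ k) I = alt_val v I *+ k ^ #|I|.
Proof.
have h (s : seq 'I_n) : uniq s -> {subset s <= I} ->
    alt_val (fun i => if i \in s then v i *+ k else v i) I = alt_val v I *+ k ^ size s.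
  elim: s => [|i s IH] /= us sI; first by rewrite expn0 mulr1n; apply: eq_alt_val.
  case/andP: us => is_ us.
  rewrite expnSr mulrnA -IH //; last by move=> j js; apply: sI; rewrite inE js orbT.
  apply: (@alt_val_scale1 _ _ _ i).
  - by apply: sI; rewrite mem_head.
  - by rewrite mem_head (negbTE is_).
  by move=> j ji; rewrite inE (negbTE ji).
rewrite cardE -h ?enum_uniq //; last by move=> i; rewrite mem_enum.
by apply: eq_alt_val => i iI; rewrite mem_enum iI.
Qed.

Lemma alt_val_transvection v w I i j : i \in I -> j \in I -> i != j ->
  w j = v j + v i -> (forall l, l != j -> w l = v l) -> alt_val w I = alt_val v I.
Proof.
move=> iI jI ij wj wl; have iIj : i \in (I :\ j)%SET by rewrite !inE ij.
rewrite /alt_val !(subset_sum_split _ _ jI) !(subset_sum_split _ _ iIj).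
apply: eq_subset_sum => J; rewrite !subsetD1 => /andP[/andP[_ jJ] iJ].
have jiJ : j \notin (i |: J)%SET by rewrite !inE negb_or eq_sym ij.
have e (K : {set 'I_n}) : j \notin K -> parallelepiped (R := R) w K = parallelepiped v K.
  move=> jK; apply: eq_parallelepiped => l lK; apply: wl.
  by apply: contraNneq jK => <-.
rewrite !(parallelepipedU1 _ jiJ) !(parallelepipedU1 _ jJ) !e //.
(* Of the four terms over J, those of J + i + j and J + j involve v_j; regrouping puts them together
   as the difference that [val_transvection] preserves. *)
rewrite !(parallelepipedU1 _ iJ) !msumA wj !mulrN1z !opprD !opprK.
rewrite [LHS]addrACA [RHS]addrACA.
by rewrite val_transvection //; exact: lattice_parallelepiped.
Qed.

Lemma alt_val_zero v I i : i \in I -> v i = 0 -> alt_val v I = 0.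
Proof.
move=> iI vi; rewrite (@alt_val_scale1 v v I i 0) ?mulr0n //.
Qed.

(* The Euclidean algorithm on the coefficients of an integer relation, performed
   by transvections of the vectors, ends with a zero vector; no division in G
   is needed. *)
Lemma alt_val_relation v (a : 'I_n -> int) I :
  \sum_(i in I) a i *: v i = 0 -> (exists2 i, i \in I & a i != 0) -> alt_val v I = 0.
Proof.
have [N] := ubnP (\sum_(i in I) `|a i|%N)%N; elim: N v a => // N IH v a.
move=> aN a0 [i iI ai].
have [j /and3P[jI ji aj]|none] :=
    pickP (fun j => [&& j \in I, j != i & a j != 0]); last first.
  apply: (alt_val_zero iI); move: a0; rewrite (bigD1 i) //= big1 ?addr0.
    by move/eqP; rewrite scalemx_eq0 (negbTE ai) /= => /eqP.
  move=> j /andP[jI ji]; have := none j; rewrite jI ji /= => /negbFE/eqP ->.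
  by rewrite scale0r.
wlog aij : i j iI ai jI ji aj / (`|a j| <= `|a i|)%N.
  move=> wl; have [h|h] := leqP `|a j| `|a i|; first exact: (wl i j).
  by apply: (wl j i) => //; rewrite 1?eq_sym // ltnW.
(* Replacing v_j by v_j + e v_i turns a_i into a_i - e a_j in the relation, so the sum of absolute
   values drops. *)
have step (e : int) w : `|a i - e * a j| < `|a i| ->
    w j = v j + e *: v i -> (forall l, l != j -> w l = v l) -> alt_val w I = 0.
  move=> ea wj wl; pose b l := if l == i then a i - e * a j else a l.
  apply: (IH w b).
  - move: aN; rewrite ltnS; apply: leq_trans; rewrite (bigD1 i) //= [X in (_ < X)%N](bigD1 i) //=.
    rewrite /b eqxx -addSn; apply: leq_add; first by lia.
    by apply: eq_leq; apply: eq_bigr => l /andP[_ /negbTE ->].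
  - rewrite -[RHS]a0 !(bigD1 (P := mem I) i) //= !(bigD1 (P := fun l => (l \in I) && (l != i)) j) /=;
      [|by rewrite jI..].
    rewrite /b eqxx (negbTE ji) wj wl 1?eq_sym // !addrA; congr (_ + _).
      by apply/rowP => l; rewrite !mxE; ring.
    by apply: eq_bigr => l /andP[/andP[_ /negbTE ->] lj]; rewrite wl.
  by exists j => //; rewrite /b (negbTE ji).
(* Since 0 < |a_j| <= |a_i|, taking e = 1 for equal signs and e = -1 for opposite ones makes |a_i|
   smaller; for e = -1 the transvection is read backwards. *)
have [sg|sg] := leP 0 (a i * a j).
  rewrite -(@alt_val_transvection v (fun l => if l == j then v j + v i else v l) I i j) //.
  - apply: (step 1); rewrite ?eqxx ?scale1r //; last by move=> l /negbTE ->.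
    nia.
  - by rewrite eq_sym.
  - by rewrite eqxx.
  - by move=> l /negbTE ->.
rewrite (@alt_val_transvection (fun l => if l == j then v j - v i else v l) v I i j) //.
- apply: (step (-1)); rewrite ?eqxx ?scaleN1r //; last by move=> l /negbTE ->.
  nia.
- by rewrite eq_sym.
- by rewrite eqxx eq_sym (negbTE ji) subrK.
- by move=> l /negbTE ->.
Qed.

Lemma val_dilate_zonotope v k :
  phi (dilate k (zonotope v)) =
  \sum_(I : {set 'I_n} | indep R v I) alt_val v I *+ k ^ #|I|.
Proof.
rewrite dilate_zonotope zonotopeE.
rewrite -(subset_sum_inv (fun J => phi (parallelepiped (fun i => v i *+ k) J))).
rewrite /subset_sum [RHS]big_mkcond /=; apply: eq_big => [I|I _].
  by rewrite finset.subsetT.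
rewrite expr1n mulr1z.
rewrite -[LHS]/(alt_val (fun i => v i *+ k) I) alt_val_scale.
case: ifPn => // /dep_int_relation[a a0 ai].
by rewrite (alt_val_relation a0 ai) mul0rn.
Qed.

End Parallelepipeds.

(** * Faces of a parallelepiped *)

Section Faces.
Variables (R : realType) (d n : nat) (v : 'I_n -> 'rV[int]_d).
Implicit Types (I J K L : {set 'I_n}) (u : 'cV[R]_d).
Local Notation V i := (lat R (v i)).
Local Notation "<< x , u >>" := ((x *m u) 0 0).

(** [K] holds the generators with free coefficient, [L] those with coefficient 1; all others have
    coefficient 0. *)
Definition subface K L : set 'rV[R]_d :=
  translate (parallelepiped v K) (\sum_(i in L) v i).

Lemma lat_sum L : lat R (\sum_(i in L) v i) = \sum_(i in L) V i.
Proof. exact: raddf_sum. Qed.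

Lemma subfaceP K L (x : 'rV[R]_d) : subface K L x <->
  exists2 l : 'I_n -> R, forall i, 0 <= l i <= 1 &
    x = \sum_(i in K) l i *: V i + \sum_(i in L) V i.
Proof.
rewrite /subface /translate lat_sum; split=> [[_ [l [l01 ->]] <-]|[l l01 ->]].
  by exists l.
by exists (\sum_(i in K) l i *: V i) => //; exists l.
Qed.

Lemma subface_set0 K : subface K finset.set0 = parallelepiped v K.
Proof.
apply/seteqP; split=> x; first by move/subfaceP=> [l l01 ->]; exists l; rewrite big_set0 addr0.
by move=> [l [l01 ->]]; apply/subfaceP; exists l; rewrite ?big_set0 ?addr0.
Qed.

Lemma dot_sum I (l : 'I_n -> R) u :
  << \sum_(i in I) l i *: V i, u >> = \sum_(i in I) l i * << V i, u >>.
Proof.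
rewrite mulmx_suml summxE; apply: eq_bigr => i _.
by rewrite -scalemxAl mxE.
Qed.

Lemma dot_sum1 I u : << \sum_(i in I) V i, u >> = \sum_(i in I) << V i, u >>.
Proof. by rewrite mulmx_suml summxE. Qed.

Definition null_dir I u := [set i in I | << V i, u >> == 0]%SET.
Definition pos_dir I u := [set i in I | 0 < << V i, u >>]%SET.

Lemma subface_sub K L I : K \subset I -> L \subset I -> [disjoint K & L] ->
  (subface K L `<=` parallelepiped v I)%classic.
Proof.
move=> KI LI KL x /subfaceP[l l01 ->].
exists (fun i => if i \in L then 1 else if i \in K then l i else 0); split.
  by move=> i; case: ifP => _; [|case: ifP => _]; rewrite ?lexx ?ler01.
rewrite big_mkcond [X in _ + X]big_mkcond [RHS]big_mkcond -big_split /=.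
apply: eq_bigr => i _; have [iK|iK] := boolP (i \in K).
  by rewrite (fintype.subsetP KI) // (disjointFr KL iK) addr0.
rewrite add0r; have [iL|iL] := boolP (i \in L); last by rewrite scale0r if_same.
by rewrite (fintype.subsetP LI) // scale1r.
Qed.

Lemma dot_le I u (l : 'I_n -> R) : (forall i, 0 <= l i <= 1) ->
  \sum_(i in I) l i * << V i, u >> <= \sum_(i in pos_dir I u) << V i, u >>.
Proof.
move=> l01; rewrite [leLHS]big_mkcond [leRHS]big_mkcond /=; apply: ler_sum => i _.
rewrite inE; case: ifP => //= _; have /andP[l0 l1] := l01 i.
by case: ltP => s; nra.
Qed.

(** The maximum of [u] is reached only if every term is maximal: coefficient 1 where [u] is
    positive, 0 where it is negative, free where it vanishes. *)
Lemma support_face I u :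
  [set x | parallelepiped v I x /\
    << x, u >> = \sum_(i in pos_dir I u) << V i, u >>]%classic =
  subface (null_dir I u) (pos_dir I u).
Proof.
have sN : null_dir I u \subset I by apply/fintype.subsetP => i; rewrite inE => /andP[].
have sP : pos_dir I u \subset I by apply/fintype.subsetP => i; rewrite inE => /andP[].
have dNP : [disjoint null_dir I u & pos_dir I u].
  rewrite finset.disjoints_subset; apply/fintype.subsetP => i; rewrite !inE.
  by case/andP=> -> /eqP ->; rewrite ltxx.
apply/seteqP; split=> x /=.
  move=> [[l [l01 ->]]]; rewrite dot_sum => e; apply/subfaceP; exists l => //.
  have g0 i : i \in I -> 0 <= (if i \in pos_dir I u then << V i, u >> else 0) -
      l i * << V i, u >>.
    move=> iI; rewrite inE iI /=; have /andP[l0 l1] := l01 i.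
    by case: ltP => s; nra.
  have s0 : \sum_(i in I) ((if i \in pos_dir I u then << V i, u >> else 0) -
      l i * << V i, u >>) = 0.
    rewrite sumrB e; apply/eqP; rewrite subr_eq0; apply/eqP.
    rewrite -big_mkcondr; apply: eq_bigl => i; rewrite andb_idl //.
    exact: (fintype.subsetP sP).
  have h := psumr_eq0P g0 s0.
  rewrite big_mkcond [X in _ = X + _]big_mkcond [X in _ = _ + X]big_mkcond -big_split /=.
  apply: eq_bigr => i _; rewrite !inE; case: ifP => [iI /=|_]; last by rewrite addr0.
  have := h i iI; rewrite inE iI /=.
  case: (ltgtP << V i, u >> 0) => s.
  - rewrite sub0r add0r => /eqP; rewrite oppr_eq0 mulf_eq0 (lt_eqF s) orbF => /eqP ->.
    by rewrite scale0r.
  - move=> /eqP; rewrite -[X in X - _]mul1r -mulrBl mulf_eq0 (gt_eqF s) orbF subr_eq0.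
    by move/eqP <-; rewrite scale1r add0r.
  by rewrite addr0.
move=> Fx; split; first exact: (subface_sub sN sP dNP).
move/subfaceP: Fx => [l l01 ->]; rewrite mulmxDl mxE dot_sum dot_sum1.
by rewrite big1 ?add0r // => i; rewrite inE => /andP[_ /eqP ->]; rewrite mulr0.
Qed.

Definition face_index I : set ({set 'I_n} * {set 'I_n}) :=
  [set p : {set 'I_n} * {set 'I_n} | (p.1 \subset I) && (p.2 \subset I :\: p.1)%SET]%classic.

Lemma subface_vertex K L : subface K L (\sum_(i in L) V i).
Proof.
apply/subfaceP; exists (fun=> 0); first by move=> i; rewrite lexx ler01.
by rewrite [X in _ = X + _]big1 ?add0r // => i _; rewrite scale0r.
Qed.

Lemma nonempty_facesE I : indep R v I ->
  nonempty_faces (parallelepiped v I) =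
  [set subface p.1 p.2 | p in face_index I]%classic.
Proof.
move=> iI; apply/seteqP; split=> F /=.
  move=> [[u [c [Pc ->]]] [x [Px xc]]].
  have cE : c = \sum_(i in pos_dir I u) << V i, u >>.
    apply/eqP; rewrite eq_le; apply/andP; split.
      by move: Px xc => [l [l01 ->]]; rewrite dot_sum => <-; exact: dot_le.
    rewrite -dot_sum1; apply: Pc.
    by have := subface_vertex (null_dir I u) (pos_dir I u); rewrite -support_face => -[].
  exists (null_dir I u, pos_dir I u) => /=; last by rewrite cE support_face.
  apply/andP; split; apply/fintype.subsetP => i; rewrite !inE; first by case/andP.
  by case/andP=> -> /gt_eqF ->.
move=> [[K L] /andP[/= KI LI] <-]; split; last by eexists; exact: subface_vertex.
(* Independence provides a functional whose null and positive generators are exactly [K] and [L]. *)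
have [u uE] := indep_dual (fun i => if i \in K then 0 else if i \in L then 1 else -1) iI.
have KE : null_dir I u = K.
  apply/setP => i; rewrite inE; have [iI'|iI'] := boolP (i \in I); last first.
    by apply/esym/negbTE; apply: contra iI'; exact: (fintype.subsetP KI).
  rewrite uE //=; case: ifP => iK; rewrite ?eqxx //; case: ifP => _.
    by rewrite oner_eq0.
  by rewrite oppr_eq0 oner_eq0.
have LE : pos_dir I u = L.
  apply/setP => i; rewrite inE; have [iI'|iI'] := boolP (i \in I); last first.
    apply/esym/negbTE; apply: contra iI' => /(fintype.subsetP LI).
    by rewrite inE => /andP[].
  rewrite uE //=; case: ifP => iK.
    rewrite ltxx; apply/esym/negbTE/negP => /(fintype.subsetP LI).
    by rewrite inE iK.
  by case: ifP => _; rewrite ?ltr01 // ltr0N1.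
exists u, (\sum_(i in L) << V i, u >>); split.
  move=> x [l [l01 ->]]; rewrite dot_sum -[X in _ <= \sum_(i in pred_of_set X) _]LE.
  exact: dot_le.
by rewrite -[in LHS]KE -LE -support_face.
Qed.

(** Dual functionals read off coefficients. A coefficient in [K] takes both values 0 and 1, possible
    only in [K']; one in [L] equals 1, which excludes the generators outside [K'] and [L']. *)
Lemma subface_le I K L K' L' : indep R v I ->
  K \subset I -> (L \subset I :\: K)%SET -> K' \subset I -> (L' \subset I :\: K')%SET ->
  (subface K L `<=` subface K' L')%classic -> K \subset K' /\ L \subset (K' :|: L')%SET.
Proof.
move=> iI KI LI K'I L'I sub.
have co (A B : {set 'I_n}) i u (l : 'I_n -> R) : A \subset I -> B \subset I ->
    {in I, forall j, << V j, u >> = (j == i)%:R} ->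
    << \sum_(j in A) l j *: V j + \sum_(j in B) V j, u >> =
      (if i \in A then l i else 0) + (if i \in B then 1 else 0).
  move=> AI BI uE; rewrite mulmxDl mxE dot_sum dot_sum1; congr (_ + _).
    rewrite (eq_bigr (fun j => if j == i then l i else 0)) => [|j jA].
      by rewrite -big_mkcondr big_andbC big_mkcondr (big_pred1 i).
    rewrite uE ?(fintype.subsetP AI) //.
    by case: eqP => [->|_]; rewrite ?mulr1 ?mulr0.
  rewrite (eq_bigr (fun j => if j == i then 1 else 0)) => [|j jB].
    by rewrite -big_mkcondr big_andbC big_mkcondr (big_pred1 i).
  by rewrite uE ?(fintype.subsetP BI) //; case: eqP.
have LI' : L \subset I := fintype.subset_trans LI (finset.subsetDl _ _).
have L'I' : L' \subset I := fintype.subset_trans L'I (finset.subsetDl _ _).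
have pt (a : R) : 0 <= a <= 1 ->
    subface K L (\sum_(i in K) a *: V i + \sum_(i in L) V i).
  by move=> a01; apply/subfaceP; exists (fun=> a).
have x0 := sub _ (pt 0 _); have x1 := sub _ (pt 1 _).
move: x0 x1; rewrite !lexx !ler01 => /(_ isT)/subfaceP[l0 _ e0] /(_ isT)/subfaceP[l1 _ e1].
split; apply/fintype.subsetP => i iKL.
  have iL : i \notin L by apply/negP => /(fintype.subsetP LI); rewrite inE iKL.
  have [u uE] := indep_dual (fun j => (j == i)%:R) iI.
  have := congr1 (fun x => << x, u >>) e0; rewrite !(co _ _ i) // iKL (negbTE iL) /=.
  have := congr1 (fun x => << x, u >>) e1; rewrite !(co _ _ i) // iKL (negbTE iL) /=.
  by case: ifP => // _; case: ifP => _; lra.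
have iK : i \notin K.
  by have := fintype.subsetP LI i iKL; rewrite inE => /andP[].
have [u uE] := indep_dual (fun j => (j == i)%:R) iI.
have := congr1 (fun x => << x, u >>) e0; rewrite !(co _ _ i) // iKL (negbTE iK) /= inE.
by case: ifP => // _; case: ifP => // _; lra.
Qed.

Lemma subface_inj I : indep R v I ->
  set_inj (face_index I) (fun p => subface p.1 p.2).
Proof.
move=> iI [K L] [K' L']; rewrite !inE /= => /andP[/= KI LI] /andP[/= K'I L'I] e.
have [|KK' LL'] := subface_le iI KI LI K'I L'I; first by rewrite e.
have [|K'K L'L] := subface_le iI K'I L'I KI LI; first by rewrite e.
have EK : K = K' by apply/eqP; rewrite finset.eqEsubset KK'.
subst K'; congr (_, _); apply/eqP; rewrite finset.eqEsubset.
apply/andP; split; apply/fintype.subsetP => i iL.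
  have := fintype.subsetP LL' i iL; have := fintype.subsetP LI i iL.
  by rewrite !inE => /andP[/negbTE -> _].
have := fintype.subsetP L'L i iL; have := fintype.subsetP L'I i iL.
by rewrite !inE => /andP[/negbTE -> _].
Qed.

Lemma aff_dim_subface K L : indep R v K -> aff_dim (subface K L) = #|K|.
Proof.
move=> iK; have Kd : (#|K| < d.+1)%N by rewrite ltnS; exact: indep_card iK.
apply/eqP; rewrite eqn_leq /aff_dim; apply/andP; split.
  apply/bigmax_leqP => k /asboolP[p [Fp]]; rewrite /aff_indep => fp.
  have sp : (<<[seq p (lift ord0 i) - p ord0 | i : 'I_k]>> <=
      <<[seq V i | i in K]>>)%VS.
    apply/span_subvP => x /mapP[i _ ->].
    have /subfaceP[l _ ->] := Fp (lift ord0 i); have /subfaceP[l' _ ->] := Fp ord0.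
    rewrite opprD addrACA subrr addr0 -sumrB; apply: memv_suml => j jK.
    rewrite -scalerBl; apply: memvZ; apply/memv_span/map_f.
    by rewrite mem_enum.
  move/dimvS: sp; rewrite (eqP fp) size_map -cardE card_ord => h.
  by apply: leq_trans h _; apply: leq_trans (dim_span _) _; rewrite size_map -cardE.
rewrite -[X in (X <= _)%N]/(nat_of_ord (Ordinal Kd)).
apply: (@leq_bigmax_cond _ _ (fun k : 'I_d.+1 => k : nat) (Ordinal Kd)); apply/asboolP => /=.
(* The base vertex and its neighbours along the generators in [K]. *)
pose p (i : 'I_#|K|.+1) := \sum_(j in L) V j +
  (if unlift ord0 i is Some k then V (enum_val k) else 0).
exists p; split=> [i|].
  rewrite /p; case: unliftP => [k|] _; last by rewrite addr0; exact: subface_vertex.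
  apply/subfaceP; exists (fun j => (j == enum_val k)%:R).
    by move=> j; case: eqP => _; rewrite ?lexx ?ler01.
  rewrite [X in _ = X + _](bigD1 (enum_val k)) ?enum_valP //= eqxx scale1r.
  rewrite [X in _ = _ + X + _]big1 ?addr0 1?addrC //.
  by move=> j /andP[_ /negbTE ->]; rewrite scale0r.
rewrite /aff_indep (_ : [seq _ | i : 'I_#|K|] = [seq V i | i in K]) //.
apply: (@eq_from_nth _ 0) => [|k]; rewrite !size_map -enumT size_enum_ord.
  by rewrite cardE.
move=> kK; pose k0 := Ordinal kK.
rewrite (nth_map k0) ?size_enum_ord // (nth_map (enum_val k0)) -?cardE //.
rewrite -[k]/(nat_of_ord k0) nth_ord_enum -enum_val_nth /p liftK unlift_none.
by rewrite addr0 addrAC subrr add0r.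
Qed.

Lemma b_valE (G : zmodType) (phi : set 'rV[R]_d -> G) I :
  Zd_valuation phi -> indep R v I ->
  b_val v phi I = subset_sum (-2) (fun K => phi (parallelepiped v K)) I.
Proof.
move=> [_ _ tr] iI; rewrite /b_val /val_relint nonempty_facesE // fsbig_image; last first.
  exact: subface_inj.
pose c (p : {set 'I_n} * {set 'I_n}) := (p.1 \subset I) && (p.2 \subset I :\: p.1)%SET.
rewrite (_ : face_index I = [set` c]%classic) //.
rewrite -(bigfs _ (index_enum_uniq _)) => [|p _]; last by rewrite mem_index_enum.
rewrite /c -(pair_big_dep (fun K => K \subset I) (fun K L => L \subset I :\: K)%SET
  (fun K L => phi (subface K L) *~
    (-1) ^+ (aff_dim (parallelepiped v I) - aff_dim (subface K L)))) /=.
apply: eq_bigr => K KI; rewrite -(subface_set0 I) aff_dim_subface //.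
(* For fixed [K] the summand is constant in [L]; the 2^|I - K| choices of [L] and the sign combine
   to (-2)^|I - K|. *)
rewrite (eq_bigr (fun=> phi (parallelepiped v K) *~ (-1) ^+ #|I :\: K|%SET)) => [|L _].
  rewrite (eq_bigl (mem (powerset (I :\: K)%SET))) => [|L]; last by rewrite /= powersetE.
  rewrite sumr_const card_powerset pmulrn -mulrzA; congr (_ *~ _).
  by rewrite -natz natrX -exprMn_comm //; exact: mulrC.
rewrite aff_dim_subface; last exact: indep_sub KI iI.
rewrite cardsD (finset.setIidPr KI); congr (_ *~ _).
by rewrite /subface tr //; exact: lattice_parallelepiped.
Qed.

End Faces.

(** * The h-polynomial of a zonotope *)

Lemma alt_val_b_val (R : realType) (d n : nat) (v : 'I_n -> 'rV[int]_d) (G : zmodType)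
    (phi : set 'rV[R]_d -> G) (I : {set 'I_n}) :
  Zd_valuation phi -> indep R v I ->
  alt_val phi v I = \sum_(J : {set 'I_n} | J \subset I) b_val v phi J.
Proof.
move=> phiV iI; rewrite /alt_val (_ : -1 = 1 + -2) // -subset_sum_comp.
apply: eq_bigr => J JI; rewrite expr1n mulr1z b_valE //.
exact: indep_sub JI iI.
Qed.

Lemma val_dilate_zonotope_basis (R : realType) (d n : nat) (v : 'I_n -> 'rV[int]_d)
    (G : zmodType) (phi : set 'rV[R]_d -> G) (k : nat) :
  spanning R v -> Zd_valuation phi ->
  phi (dilate k (zonotope v)) =
  \sum_(J : {set 'I_n} | indep R v J) b_val v phi J *~
    (\sum_(B : {set 'I_n} | basis R v B && (J \subset B))
       (k ^ #|J :|: IP R v B|%SET * k.+1 ^ (d - #|J :|: IP R v B|%SET))%N%:Z).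
Proof.
move=> spv phiV; rewrite val_dilate_zonotope //.
transitivity (\sum_(I : {set 'I_n} | indep R v I)
    \sum_(J : {set 'I_n} | J \subset I) b_val v phi J *~ k%:Z ^+ #|I|).
  apply: eq_bigr => I iI; rewrite alt_val_b_val // pmulrn mulrz_suml.
  by apply: eq_bigr => J _; rewrite -natz natrX natz.
rewrite (exchange_big_dep (fun J => indep R v J)) /=; last first.
  by move=> I J iI JI; exact: indep_sub JI iI.
apply: eq_bigr => J iJ; rewrite -mulrz_sumr (sum_indep_basis spv); congr (_ *~ _).
apply: eq_bigr => B _; rewrite PoszM -!natz !natrX !natz; congr (_ * _ ^+ _).
Qed.

Theorem theorem1p4 (R : realType) (d n : nat) (v : 'I_n -> 'rV[int]_d)
    (G : zmodType) (phi : set 'rV[R]_d -> G) :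
  spanning R v -> Zd_valuation phi ->
  is_hpoly phi (zonotope v)
    (fun k => \sum_(I : {set 'I_n} | indep R v I)
       b_val v phi I *~
         (\sum_(B : {set 'I_n} | basis R v B && (I \subset B))
            A_poly (#|I :|: IP R v B| + 1) d.+1)`_k).
Proof.
move=> spv phiV; split.
  pose p (I : {set 'I_n}) := \sum_(B : {set 'I_n} | basis R v B && (I \subset B))
    A_poly (#|I :|: IP R v B|%SET + 1) d.+1.
  exists (\max_(I : {set 'I_n}) size (p I))%N => k kN; apply: big1 => I _.
  rewrite -/(p I) nth_default ?mulr0z //; apply: leq_trans kN.
  exact: (leq_bigmax (F := fun I => size (p I)) I).
apply: funext => k; rewrite /poly_act.
under eq_bigr => i _ do rewrite val_dilate_zonotope_basis // mulrz_suml.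
rewrite exchange_big /=; apply: eq_bigr => I iI.
under eq_bigr => i _ do rewrite -mulrzA.
rewrite -mulrz_sumr coef_sum; congr (_ *~ _).
under eq_bigr => i _ do rewrite mulr_suml.
rewrite exchange_big /=; apply: eq_bigr => B /andP[bB IB].
(* The bound on the index holds because I and IP(B) lie in B, which has at most d elements. *)
rewrite addn1 A_poly_coef; last first.
  apply: leq_trans (indep_card (basis_indep bB)); apply: subset_leq_card.
  by rewrite finset.subUset IB IP_sub.
by apply: eq_bigr => i _; rewrite mulrC.
Qed.
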